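(* For every integer $q\geq 2$ and every odd integer $p\geq 1$, $$\begin{aligned}&(-1)^{q-1}\sum_{\substack{i+j=p-1\\ i,j\geq 0}}\binom{q+i-1}{i}\binom{q+j-1}{j}T_{q+i,q+j}+\sum_{\substack{i+j=q-1\\ i,j\geq 0}}\binom{p+i-1}{i}\binom{q+j-1}{j}\tilde S_{p+i,q+j}\\&\quad=(-1)^{q-1}\sum_{\substack{0\leq i\leq p-1\\ q+i\ \mathrm{odd}}}\binom{q+i-1}{i}\binom{p+q-2-i}{p-1-i}\tilde t(q+i)\,\tilde t(p+q-1-i)\\&\qquad+\frac{(-1)^{\frac{p-1}{2}}}{8}\binom{p-2+2q}{p-1}\frac{G_{p-1+2q}}{(p-1+2q)!}(2\pi)^{p-1+2q}.\end{aligned}$$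
   Context: For integers $n\ge 0$, $r\geq 1$: $h_0^{(r)}=0$ and $h_n^{(r)}=\sum_{k=1}^n\frac{1}{(k-1/2)^r}$. For integers $a\geq 1$, $b\geq 2$: $T_{a,b}=\sum_{n=1}^\infty\frac{h_{n-1}^{(a)}}{(n-1/2)^b}$ and $\tilde S_{a,b}=\sum_{n=1}^\infty\frac{h_n^{(a)}}{n^b}$. For integers $s\geq 2$: $\tilde t(s)=\sum_{n=1}^\infty\frac{1}{(n-1/2)^s}=(2^s-1)\zeta(s)$. $G_n$ are the Genocchi numbers, defined by $\frac{2t}{e^t+1}=\sum_{n=1}^\infty G_n\frac{t^n}{n!}$. Empty sums are $0$. *)

(* Defs.v *)
From Stdlib Require Import Reals Lra Lia Arith.
From Coquelicot Require Import Coquelicot.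
Open Scope R_scope.

(* [u 1 + u 2 + u 3 + ...]; like [Series], it is meaningful only when the
   series converges. *)
Definition series1 (u : nat -> R) : R := Series (fun k => u (S k)).

(* The sum of [f i j] over all naturals [i], [j] with [i + j = N]. *)
Definition sum_add_eq (N : nat) (f : nat -> nat -> R) : R :=
  sum_n (fun i => f i (N - i)%nat) N.

Definition h (r n : nat) : R :=
  sum_n_m (fun k => 1 / (INR k - 1 / 2) ^ r) 1 n.

Definition T (a b : nat) : R :=
  series1 (fun n => h a (n - 1) / (INR n - 1 / 2) ^ b).

Definition S_tilde (a b : nat) : R :=
  series1 (fun n => h a n / INR n ^ b).

Definition t_tilde (s : nat) : R :=
  series1 (fun n => 1 / (INR n - 1 / 2) ^ s).

(* [G 1, G 2, ...] are the Genocchi numbers: the generating function identity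
   holds on some neighbourhood of 0.  The value [G 0] is left free. *)
Definition is_genocchi (G : nat -> R) : Prop :=
  exists rho : R, 0 < rho /\
    forall t : R, Rabs t < rho ->
      is_series (fun k => let n := S k in G n * (t ^ n / INR (fact n)))
                (2 * t / (exp t + 1)).

(* Such a sequence exists: with [2 / (e^t + 1)] = sum of [a n * t ^ n], take
   [G n = n! * a (n - 1)]. *)
Fixpoint genocchi_tab (n : nat) : nat -> R :=
  match n with
  | O => fun _ => 1
  | S m => fun k =>
      if (k <=? m)%nat then genocchi_tab m k
      else - / 2 * sum_f_R0 (fun j => genocchi_tab m j * / INR (fact (k - j))) m
  end.

Definition genocchi_coef (n : nat) : R := genocchi_tab n n.

Lemma genocchi_tab_coef (n k : nat) :
  (k <= n)%nat -> genocchi_tab n k = genocchi_coef k.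
Proof.
  induction n as [|n IH]; intros Hk.
  - now replace k with 0%nat by lia.
  - destruct (Nat.eq_dec k (S n)) as [->|Hne]; [easy|].
    simpl. replace (k <=? n)%nat with true by (symmetry; apply Nat.leb_le; lia).
    apply IH; lia.
Qed.

Lemma genocchi_coefS (n : nat) :
  genocchi_coef (S n) =
  - / 2 * sum_f_R0 (fun j => genocchi_coef j * / INR (fact (S n - j))) n.
Proof.
  unfold genocchi_coef at 1. cbn [genocchi_tab].
  replace (S n <=? n)%nat with false by (symmetry; apply Nat.leb_gt; lia).
  f_equal. apply sum_eq. intros i Hi. now rewrite genocchi_tab_coef.
Qed.

Lemma inv_fact_le_half_pow (m : nat) : / INR (fact (S m)) <= (/ 2) ^ m.
Proof.
  induction m as [|m IH]; [simpl; lra|].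
  change (fact (S (S m))) with (S (S m) * fact (S m))%nat.
  rewrite mult_INR, Rinv_mult. cbn [pow].
  assert (H : / INR (S (S m)) <= / 2).
  { apply Rinv_le_contravar; [lra|]. rewrite !S_INR. pose proof (pos_INR m); lra. }
  apply Rmult_le_compat; auto; left; apply Rinv_0_lt_compat; apply lt_0_INR;
    [lia | apply lt_O_fact].
Qed.

Lemma genocchi_coef_le1 (n : nat) : Rabs (genocchi_coef n) <= 1.
Proof.
  induction n as [[|n] IH] using (well_founded_induction lt_wf).
  - unfold genocchi_coef; simpl. rewrite Rabs_R1; lra.
  - rewrite genocchi_coefS, Rabs_mult, Rabs_Ropp, (Rabs_pos_eq (/ 2)) by lra.
    assert (H : Rabs (sum_f_R0 (fun j => genocchi_coef j * / INR (fact (S n - j))) n)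
                <= sum_f_R0 (fun j => (/ 2) ^ (n - j)) n).
    { eapply Rle_trans; [apply Rsum_abs|]. apply sum_Rle. intros j Hj.
      rewrite Rabs_mult. replace (S n - j)%nat with (S (n - j)) by lia.
      rewrite (Rabs_pos_eq (/ _))
        by (left; apply Rinv_0_lt_compat, INR_fact_lt_0).
      rewrite <- (Rmult_1_l ((/ 2) ^ _)).
      apply Rmult_le_compat; [apply Rabs_pos | | apply IH; lia |
        apply inv_fact_le_half_pow].
      left; apply Rinv_0_lt_compat, INR_fact_lt_0. }
    assert (H2 : sum_f_R0 (fun j => (/ 2) ^ (n - j)) n = 2 - (/ 2) ^ n).
    { clear. induction n as [|n IH]; [simpl; lra|].
      rewrite decomp_sum by lia. cbn [Nat.pred].
      rewrite (sum_eq _ (fun j => (/ 2) ^ (n - j))) by (intros; f_equal; lia).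
      rewrite IH. rewrite Nat.sub_0_r. simpl. lra. }
    assert (H3 : 0 < (/ 2) ^ n) by (apply pow_lt; lra).
    lra.
Qed.

Lemma genocchi_coef_series (t : R) : Rabs t < 1 ->
  is_pseries genocchi_coef t (2 / (exp t + 1)).
Proof.
  intros Ht.
  assert (Hr : Rbar_le 1 (CV_radius genocchi_coef)).
  { apply CV_radius_bounded. exists 1. intros n. rewrite pow1, Rmult_1_r.
    apply genocchi_coef_le1. }
  assert (Hr1 : Rbar_lt (Rabs t) (CV_radius genocchi_coef))
    by (eapply Rbar_lt_le_trans; [|exact Hr]; exact Ht).
  pose proof (CV_radius_inside _ _ Hr1) as Hex.
  apply PSeries_correct in Hex.
  set (e := fun n : nat => / INR (fact n)).
  assert (He : is_pseries e t (exp t)) by apply is_exp_Reals.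
  assert (Hre : Rbar_lt (Rabs t) (CV_radius e)).
  { unfold e. rewrite CV_radius_infinite_DAlembert; [easy| |].
    - intros n. apply Rinv_neq_0_compat, INR_fact_neq_0.
    - apply is_lim_seq_ext with (fun n => / INR (S n)).
      + intros n. change (fact (S n)) with (S n * fact n)%nat.
        rewrite mult_INR.
        assert (Hn : 0 < INR (S n)) by (apply lt_0_INR; lia).
        pose proof (INR_fact_lt_0 n).
        replace (_ / _) with (/ INR (S n)) by (field; lra).
        rewrite Rabs_pos_eq; [easy|left; now apply Rinv_0_lt_compat].
      + apply is_lim_seq_incr_1 with (u := fun n => / INR n).
        replace (Finite 0) with (Rbar_inv p_infty) by easy.
        apply is_lim_seq_inv; [apply is_lim_seq_INR | easy]. }
  pose proof (is_pseries_mult _ _ _ _ _ Hex He Hr1 Hre) as Hm.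
  pose proof (is_pseries_plus _ _ _ _ _ Hm Hex) as Hp.
  assert (H2 : is_pseries (PS_plus (PS_mult genocchi_coef e) genocchi_coef) t 2).
  { apply is_series_ext with (fun n : nat => match n with O => 2 | _ => 0 end).
    - assert (Hc : forall n, PS_plus (PS_mult genocchi_coef e) genocchi_coef n
                             = match n with O => 2 | _ => 0 end).
      { intros n. unfold PS_plus, PS_mult, plus. cbn -[fact INR sum_f_R0].
        destruct n as [|n].
        - unfold e, genocchi_coef. simpl. rewrite Rinv_1. lra.
        - rewrite tech5, Nat.sub_diag. unfold e.
          replace (/ INR (fact 0)) with 1 by (simpl; lra).
          rewrite genocchi_coefS. lra. }
      intros n. rewrite Hc. destruct n as [|n];
        unfold scal; simpl; unfold mult, one; simpl; lra.
    - match goal with |- is_series ?u ?l => change (is_lim_seq (sum_n u) l) end.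
      apply is_lim_seq_ext with (fun _ : nat => 2); [|apply is_lim_seq_const].
      intros n. induction n as [|n IH]; [now rewrite sum_O|].
      rewrite sum_Sn, <- IH. unfold plus; simpl; lra. }
  apply is_pseries_unique in Hp. apply is_pseries_unique in H2.
  rewrite H2 in Hp. unfold plus in Hp; simpl in Hp.
  pose proof (exp_pos t).
  replace (2 / (exp t + 1)) with (PSeries genocchi_coef t); [easy|].
  rewrite Hp. field. lra.
Qed.

Lemma is_genocchi_ex : exists G : nat -> R, is_genocchi G.
Proof.
  exists (fun n => INR (fact n) * genocchi_coef (n - 1)), 1.
  split; [lra|]. intros t Ht.
  pose proof (is_series_scal t _ _ (genocchi_coef_series t Ht)) as H.
  replace (2 * t / (exp t + 1)) with (scal t (2 / (exp t + 1)))
    by (unfold scal; simpl; unfold mult; simpl; pose proof (exp_pos t); field; lra).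
  eapply is_series_ext; [|exact H].
  intros n. cbv zeta. replace (S n - 1)%nat with n by lia.
  rewrite pow_n_pow. unfold scal; simpl; unfold mult; simpl.
  pose proof (INR_fact_lt_0 (S n)) as Hf. simpl fact in Hf. field. lra.
Qed.

(* Main.v *)
Require Import Defs.
From Stdlib Require Import Reals Arith.
From Coquelicot Require Import Coquelicot.
From Stdlib Require Import Lra Lia.
Open Scope R_scope.

(** Write [r = p - 1], which is even, [x_n = n + 1/2] for [n >= 0], and let
    [multichoose q i] be the coefficient of [t ^ i] in [(1 - t) ^ (- q)]. The
    binomial coefficients of the theorem are of this kind, so that its sums
    over [i + j = r] are coefficients of [t ^ r] in products of powers of
    linear forms in [t].

    Exchanging [i] and [j] replaces twice the sum of the [T] by the sum of
    [T a b + T b a = t_tilde a * t_tilde b - t_tilde (a + b)], with [a = q + i]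
    and [b = q + j]. By the Vandermonde identity, [t_tilde (2 q + r)] occurs
    there with the coefficient [multichoose (2 q) r] ([T_sum]).

    For the sum of the [S_tilde], take the coefficient of [t ^ r] in the
    partial fraction expansion of [(x_m + t) ^ (- q) * (x_n - t) ^ (- q)]
    ([two_poles_partial_fractions]). The terms of this expansion have a power of
    [x_m + x_n = m + n + 1] and a power of only one of [x_m] and [x_n] in the
    denominator. Summing over all [m] and [n], the side of the
    products becomes the sum of [(-1) ^ i * t_tilde (q + i) * t_tilde (q + j)]
    with the coefficients [multichoose q i * multichoose q j]. On the other
    side, the pairs with [m + n = N] give the terms of index [N + 1] of the
    series [S_tilde], twice because [r] is even ([S_tilde_sum]). Adding this
    alternating sum to the sum found for the [T] cancels the products with
    [q + i] even and doubles the others.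

    It remains to express [t_tilde (2 q + r)], at an even argument, by a
    Genocchi number ([genocchi_t_even]). A computation with finite square sums
    evaluates the convolution of the even values with itself
    ([t_even_convolution]). It is a Riccati equation for their generating
    function, whose solutions are tangents. The pole of the tangent at the
    radius of convergence fixes the one constant left, [t_tilde 2 = PI ^ 2 / 2],
    and for negative arguments the solution becomes [tanh (t / 2)], where
    [2 * t / (exp t + 1) = t - t * tanh (t / 2)]. *)

(** * Finite sums *)

Lemma sum_n_eq (f g : nat -> R) (n : nat) :
  (forall k, (k <= n)%nat -> f k = g k) -> sum_n f n = sum_n g n :> R.
Proof. apply (sum_n_ext_loc f g n). Qed.

Lemma sum_n_plus_R (f g : nat -> R) (n : nat) :
  sum_n (fun k => f k + g k) n = sum_n f n + sum_n g n :> R.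
Proof. apply (sum_n_plus f g n). Qed.

Lemma sum_n_scal (c : R) (f : nat -> R) (n : nat) :
  sum_n (fun k => c * f k) n = c * sum_n f n :> R.
Proof. apply (sum_n_mult_l (K := R_Ring) c f n). Qed.

Lemma sum_n_scal_r (c : R) (f : nat -> R) (n : nat) :
  sum_n (fun k => f k * c) n = sum_n f n * c :> R.
Proof. apply (sum_n_mult_r (K := R_Ring) c f n). Qed.

Lemma sum_n_minus_R (f g : nat -> R) (n : nat) :
  sum_n (fun k => f k - g k) n = sum_n f n - sum_n g n :> R.
Proof.
  rewrite (sum_n_eq _ (fun k => f k + (-1) * g k)) by (intros; ring).
  rewrite sum_n_plus_R, sum_n_scal. ring.
Qed.

Lemma sum_n_Sr (f : nat -> R) (n : nat) : sum_n f (S n) = sum_n f n + f (S n) :> R.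
Proof. apply (sum_Sn f n). Qed.

Lemma sum_n_Sl (f : nat -> R) (n : nat) :
  sum_n f (S n) = f 0%nat + sum_n (fun k => f (S k)) n :> R.
Proof.
  induction n as [|n IH]; [now rewrite sum_n_Sr, !sum_O|].
  rewrite sum_n_Sr, IH, (sum_n_Sr (fun k => f (S k))). ring.
Qed.

Lemma sum_n_le (f g : nat -> R) (n : nat) :
  (forall k, (k <= n)%nat -> f k <= g k) -> sum_n f n <= sum_n g n.
Proof.
  induction n as [|n IH]; intros H; [rewrite !sum_O; auto|].
  rewrite !sum_n_Sr. apply Rplus_le_compat; auto.
Qed.

Lemma sum_n_nonneg (f : nat -> R) (n : nat) :
  (forall k, (k <= n)%nat -> 0 <= f k) -> 0 <= sum_n f n.
Proof.
  intros H. rewrite <- (Rmult_0_r (INR (S n))), <- sum_n_const.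
  now apply sum_n_le.
Qed.

Lemma sum_n_rev (f : nat -> R) (n : nat) :
  sum_n f n = sum_n (fun k => f (n - k)%nat) n :> R.
Proof.
  revert f. induction n as [|n IH]; intros f; [now rewrite !sum_O|].
  rewrite sum_n_Sl, (sum_n_Sr (fun k => _)), IH.
  rewrite (sum_n_eq (fun k => f (S n - k)%nat) (fun k => f (S (n - k))))
    by (intros; f_equal; lia).
  rewrite Nat.sub_diag. ring.
Qed.

Lemma sum_n_delta (c : nat -> R) (m n : nat) : (m <= n)%nat ->
  sum_n (fun k => if (m =? k)%nat then c k else 0) n = c m :> R.
Proof.
  revert m c. induction n as [|n IH]; intros m c Hm.
  - now replace m with 0%nat by lia; rewrite sum_O.
  - rewrite sum_n_Sl. destruct m as [|m].
    + rewrite (sum_n_eq _ (fun _ : nat => 0)), sum_n_const by easy.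
      cbn [Nat.eqb]. ring.
    + pose proof (IH m (fun k => c (S k)) ltac:(lia)) as E.
      cbn [Nat.eqb] in *. rewrite E.  ring.
Qed.

(** * Sums over the pairs of given sum *)

Lemma sum_add_eq_ext (n : nat) (f g : nat -> nat -> R) :
  (forall i j, (i + j = n)%nat -> f i j = g i j) ->
  sum_add_eq n f = sum_add_eq n g.
Proof. intros H. apply sum_n_eq. intros i Hi. apply H. lia. Qed.

Lemma sum_add_eq_0 (f : nat -> nat -> R) : sum_add_eq 0 f = f 0%nat 0%nat.
Proof. exact (sum_O (fun i => f i (0 - i)%nat)). Qed.

Lemma sum_add_eq_swap (n : nat) (f : nat -> nat -> R) :
  sum_add_eq n f = sum_add_eq n (fun i j => f j i).
Proof.
  unfold sum_add_eq. rewrite sum_n_rev. apply sum_n_eq.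
  intros i Hi. now replace (n - (n - i))%nat with i by lia.
Qed.

Lemma sum_add_eq_Sl (n : nat) (f : nat -> nat -> R) :
  sum_add_eq (S n) f = f 0%nat (S n) + sum_add_eq n (fun i j => f (S i) j).
Proof. exact (sum_n_Sl (fun i => f i (S n - i)%nat) n). Qed.

Lemma sum_add_eq_Sr (n : nat) (f : nat -> nat -> R) :
  sum_add_eq (S n) f = f (S n) 0%nat + sum_add_eq n (fun i j => f i (S j)).
Proof.
  now rewrite sum_add_eq_swap, sum_add_eq_Sl, (sum_add_eq_swap n).
Qed.

Lemma sum_add_eq_plus (n : nat) (f g : nat -> nat -> R) :
  sum_add_eq n (fun i j => f i j + g i j) = sum_add_eq n f + sum_add_eq n g.
Proof. exact (sum_n_plus_R (fun i => f i (n - i)%nat) (fun i => g i (n - i)%nat) n). Qed.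

Lemma sum_add_eq_minus (n : nat) (f g : nat -> nat -> R) :
  sum_add_eq n (fun i j => f i j - g i j) = sum_add_eq n f - sum_add_eq n g.
Proof. exact (sum_n_minus_R (fun i => f i (n - i)%nat) (fun i => g i (n - i)%nat) n). Qed.

Lemma sum_add_eq_scal (n : nat) (c : R) (f : nat -> nat -> R) :
  sum_add_eq n (fun i j => c * f i j) = c * sum_add_eq n f.
Proof. exact (sum_n_scal c (fun i => f i (n - i)%nat) n). Qed.

Lemma sum_add_eq_nonneg (n : nat) (f : nat -> nat -> R) :
  (forall i j, 0 <= f i j) -> 0 <= sum_add_eq n f.
Proof. intros H. apply sum_n_nonneg. auto. Qed.

Lemma sum_n_sum_add_eq (n m : nat) (f : nat -> nat -> nat -> R) :
  sum_n (fun k => sum_add_eq n (f k)) m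
  = sum_add_eq n (fun i j => sum_n (fun k => f k i j) m).
Proof. exact (sum_n_switch (fun k i => f k i (n - i)%nat) m n). Qed.

Lemma sum_add_eq_ge (n i j : nat) (f : nat -> nat -> R) :
  (forall a b, 0 <= f a b) -> (i + j = n)%nat -> f i j <= sum_add_eq n f.
Proof.
  revert i j f. induction n as [|n IH]; intros i j f Hf Hij.
  - rewrite sum_add_eq_0. replace i with 0%nat by lia.
    replace j with 0%nat by lia. lra.
  - destruct i as [|i].
    + replace j with (S n) by lia. rewrite sum_add_eq_Sl.
      pose proof (sum_add_eq_nonneg n (fun i j => f (S i) j)
        (fun a b => Hf (S a) b)). lra.
    + rewrite sum_add_eq_Sl.
      pose proof (IH i j (fun i j => f (S i) j) (fun a b => Hf (S a) b)
        ltac:(lia)). simpl in H. pose proof (Hf 0%nat (S n)). lra.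
Qed.

(** * Multiset coefficients *)

(** The coefficient of [t ^ j] in [(1 - t) ^ (- a)]. Unlike
    [Binomial.C (a + j - 1) j], it obeys Pascal's rule also for [a = 0], where
    the inductions below start. *)
Fixpoint multichoose (a : nat) : nat -> R :=
  match a with
  | O => fun j => match j with O => 1 | S _ => 0 end
  | S b => fix row j :=
      match j with O => 1 | S k => multichoose b (S k) + row k end
  end.

Lemma multichoose_n_0 (a : nat) : multichoose a 0 = 1.
Proof. now destruct a. Qed.

Lemma multichoose_pascal (a j : nat) :
  multichoose (S a) (S j) = multichoose a (S j) + multichoose (S a) j.
Proof. easy. Qed.

Lemma multichoose_0_S (j : nat) : multichoose 0 (S j) = 0.
Proof. easy. Qed.

Lemma multichoose_1 (j : nat) : multichoose 1 j = 1.
Proof.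
  induction j as [|j IH]; [easy|].
  rewrite multichoose_pascal, IH, multichoose_0_S. ring.
Qed.

Local Opaque multichoose.

Lemma multichoose_C (a j : nat) :
  multichoose (S a) j = Binomial.C (a + j) j.
Proof.
  revert j. induction a as [|a IHa]; intros j.
  - now rewrite multichoose_1, C_n_n.
  - induction j as [|j IHj]; [now rewrite multichoose_n_0, C_n_0|].
    rewrite multichoose_pascal, IHa, IHj.
    replace (a + S j)%nat with (S (a + j)) by lia.
    replace (S a + j)%nat with (S (a + j)) by lia.
    replace (S a + S j)%nat with (S (S (a + j))) by lia.
    rewrite <- (pascal (S (a + j)) j) by lia. ring.
Qed.

Lemma C_multichoose (a j : nat) : (1 <= a)%nat ->
  Binomial.C (a + j - 1) j = multichoose a j.
Proof.
  intros Ha. destruct a as [|a]; [lia|]. rewrite multichoose_C.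
  f_equal. lia.
Qed.

Lemma multichoose_nonneg (a j : nat) : 0 <= multichoose a j.
Proof.
  revert j. induction a as [|a IHa]; intros j.
  - destruct j; [rewrite multichoose_n_0|rewrite multichoose_0_S]; lra.
  - induction j as [|j IHj]; [rewrite multichoose_n_0; lra|].
    rewrite multichoose_pascal. specialize (IHa (S j)). lra.
Qed.

Lemma multichoose_sym (a j : nat) :
  multichoose (S a) j = multichoose (S j) a.
Proof.
  rewrite !multichoose_C, pascal_step1 by lia. f_equal; lia.
Qed.

(** Compare coefficients in [(1 - t)^(-a) (1 - t)^(-b) = (1 - t)^(-(a+b))]. *)
Lemma multichoose_vandermonde (a b r : nat) :
  sum_add_eq r (fun i j => multichoose a i * multichoose b j)
  = multichoose (a + b) r.
Proof.
  revert r. induction a as [|a IHa]; intros r.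
  - destruct r as [|r].
    + rewrite sum_add_eq_0, !multichoose_n_0. ring.
    + rewrite sum_add_eq_Sl, multichoose_n_0.
      rewrite (sum_add_eq_ext _ _ (fun i j => 0 * 0)).
      * rewrite sum_add_eq_scal. simpl. ring.
      * intros i j _. rewrite multichoose_0_S. ring.
  - induction r as [|r IHr].
    + rewrite sum_add_eq_0, !multichoose_n_0. ring.
    + change (S a + b)%nat with (S (a + b)) in *.
      rewrite multichoose_pascal, <- IHa, <- IHr.
      rewrite !(sum_add_eq_Sl r), !multichoose_n_0.
      rewrite (sum_add_eq_ext r (fun i j => multichoose (S a) (S i) * _)
        (fun i j => multichoose a (S i) * multichoose b j
                    + multichoose (S a) i * multichoose b j)).
      * rewrite sum_add_eq_plus. ring.
      * intros i j _. rewrite multichoose_pascal. ring.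
Qed.

(** * Partial fractions *)

(** The coefficient of [t ^ i] in [(x - t) ^ (- a)]. *)
Definition pole_coef (x : R) (a i : nat) : R :=
  multichoose a i / x ^ (a + i).

Lemma pole_coef_S (x : R) (a i : nat) : x <> 0 ->
  x * pole_coef x (S a) (S i) = pole_coef x a (S i) + pole_coef x (S a) i.
Proof.
  intros Hx. unfold pole_coef. rewrite multichoose_pascal.
  replace (S a + S i)%nat with (S (a + S i)) by lia.
  replace (S a + i)%nat with (a + S i)%nat by lia.
  simpl pow. field. split; auto. now apply pow_nonzero.
Qed.

Lemma pole_coef_S0 (x : R) (a : nat) : x <> 0 ->
  x * pole_coef x (S a) 0 = pole_coef x a 0.
Proof.
  intros Hx. unfold pole_coef. rewrite !multichoose_n_0.
  simpl. field. split; auto. now apply pow_nonzero.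
Qed.

(** The coefficient of [t ^ r] in [(x + t) ^ (- a) * (y - t) ^ (- b)]. *)
Definition two_poles_coef (x y : R) (r a b : nat) : R :=
  sum_add_eq r (fun i j => (-1) ^ i * pole_coef x a i * pole_coef y b j).

(** This is [(x + t) + (y - t) = x + y], multiplied by
    [(x + t) ^ (- a - 1) * (y - t) ^ (- b - 1)]. *)
Lemma two_poles_coef_rec (x y : R) (r a b : nat) : x <> 0 -> y <> 0 ->
  (x + y) * two_poles_coef x y r (S a) (S b)
  = two_poles_coef x y r a (S b) + two_poles_coef x y r (S a) b.
Proof.
  intros Hx Hy. unfold two_poles_coef.
  rewrite Rmult_plus_distr_r, <- !sum_add_eq_scal.
  destruct r as [|r].
  - rewrite !sum_add_eq_0, <- (pole_coef_S0 x a), <- (pole_coef_S0 y b) by auto. ring.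
  - rewrite (sum_add_eq_Sl r (fun i j => x * _)).
    rewrite (sum_add_eq_Sl r (fun i j => _ * pole_coef x a i * _)).
    rewrite (sum_add_eq_Sr r (fun i j => y * _)).
    rewrite (sum_add_eq_Sr r (fun i j => _ * pole_coef y b j)).
    rewrite (sum_add_eq_ext r (fun i j => x * _) (fun i j =>
      (-1) ^ S i * pole_coef x a (S i) * pole_coef y (S b) j
      - (-1) ^ i * pole_coef x (S a) i * pole_coef y (S b) j)).
    2:{ intros i j _. transitivity ((-1) ^ S i
          * (x * pole_coef x (S a) (S i)) * pole_coef y (S b) j); [ring|].
        rewrite pole_coef_S by auto. simpl pow. ring. }
    rewrite (sum_add_eq_ext r (fun i j => y * _) (fun i j =>
      (-1) ^ i * pole_coef x (S a) i * pole_coef y b (S j)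
      + (-1) ^ i * pole_coef x (S a) i * pole_coef y (S b) j)).
    2:{ intros i j _. transitivity ((-1) ^ i * pole_coef x (S a) i
          * (y * pole_coef y (S b) (S j))); [ring|].
        rewrite pole_coef_S by auto. ring. }
    rewrite sum_add_eq_minus, sum_add_eq_plus.
    rewrite <- (pole_coef_S0 x a), <- (pole_coef_S0 y b) by auto. ring.
Qed.

Lemma two_poles_coef_0_l (x y : R) (r b : nat) :
  two_poles_coef x y r 0 b = pole_coef y b r.
Proof.
  unfold two_poles_coef. destruct r as [|r].
  - rewrite sum_add_eq_0. unfold pole_coef at 1. rewrite multichoose_n_0.
    simpl. field.
  - rewrite sum_add_eq_Sl.
    rewrite (sum_add_eq_ext _ _ (fun i j => 0 * 0)).
    + rewrite sum_add_eq_scal. unfold pole_coef at 1. rewrite multichoose_n_0.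
      simpl. field.
    + intros i j _. unfold pole_coef at 1. rewrite multichoose_0_S.
      unfold Rdiv. ring.
Qed.

Lemma two_poles_coef_0_r (x y : R) (r a : nat) :
  two_poles_coef x y r a 0 = (-1) ^ r * pole_coef x a r.
Proof.
  unfold two_poles_coef. destruct r as [|r].
  - rewrite sum_add_eq_0. unfold pole_coef at 2. rewrite multichoose_n_0.
    simpl. field.
  - rewrite sum_add_eq_Sr.
    rewrite (sum_add_eq_ext _ _ (fun i j => 0 * 0)).
    + rewrite sum_add_eq_scal. unfold pole_coef at 2. rewrite multichoose_n_0.
      simpl. field.
    + intros i j _. unfold pole_coef at 2. rewrite multichoose_0_S.
      unfold Rdiv. ring.
Qed.

(** For [beta 0 = 0], the solution of the recurrence of [two_poles_coef_rec]
    which is [beta] on the axis [a = 0] and vanishes on the axis [b = 0].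
    Unfolding the recurrence sums over lattice paths, each step of which
    divides by [N]: [multichoose a j] of them go from [(a, b)] to
    [(0, b - j)]. *)
Definition lattice_sol (N : R) (beta : nat -> R) (a b : nat) : R :=
  sum_add_eq b (fun j k => multichoose a j / N ^ (a + j) * beta k).

Lemma lattice_sol_rec (N : R) (beta : nat -> R) (a b : nat) : N <> 0 ->
  N * lattice_sol N beta (S a) (S b)
  = lattice_sol N beta a (S b) + lattice_sol N beta (S a) b.
Proof.
  intros HN. unfold lattice_sol. rewrite !(sum_add_eq_Sl b).
  rewrite Rmult_plus_distr_l, <- sum_add_eq_scal.
  rewrite (sum_add_eq_ext b (fun i j => N * _) (fun i j =>
    multichoose a (S i) / N ^ (a + S i) * beta j
    + multichoose (S a) i / N ^ (S a + i) * beta j)).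
  - rewrite sum_add_eq_plus, !multichoose_n_0. simpl.
    field. split; auto. now apply pow_nonzero.
  - intros i j _. rewrite multichoose_pascal.
    replace (S a + S i)%nat with (S (a + S i)) by lia.
    replace (S a + i)%nat with (a + S i)%nat by lia.
    simpl pow. field. split; auto. now apply pow_nonzero.
Qed.

Lemma lattice_sol_0_l (N : R) (beta : nat -> R) (b : nat) :
  lattice_sol N beta 0 b = beta b.
Proof.
  unfold lattice_sol. destruct b as [|b].
  - rewrite sum_add_eq_0, multichoose_n_0. simpl. field.
  - rewrite sum_add_eq_Sl, (sum_add_eq_ext _ _ (fun i j => 0 * 0)).
    + rewrite sum_add_eq_scal, multichoose_n_0. simpl. field.
    + intros i j _. rewrite multichoose_0_S. unfold Rdiv. ring.
Qed.

Lemma lattice_sol_0_r (N : R) (beta : nat -> R) (a : nat) :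
  beta 0%nat = 0 -> lattice_sol N beta a 0 = 0.
Proof.
  intros H. unfold lattice_sol. rewrite sum_add_eq_0, H. ring.
Qed.

(** The recurrence determines [w] from its values on the two axes. *)
Lemma lattice_sol_unique (N : R) (beta gamma : nat -> R)
    (w : nat -> nat -> R) : N <> 0 ->
  beta 0%nat = 0 -> gamma 0%nat = 0 ->
  (forall a b, N * w (S a) (S b) = w a (S b) + w (S a) b) ->
  (forall b, w 0%nat (S b) = beta (S b)) ->
  (forall a, w (S a) 0%nat = gamma (S a)) ->
  forall a b, w (S a) (S b)
    = lattice_sol N beta (S a) (S b) + lattice_sol N gamma (S b) (S a).
Proof.
  intros HN Hb0 Hg0 Hrec Hb Hg.
  assert (Hl : forall b, w 0%nat (S b)
    = lattice_sol N beta 0 (S b) + lattice_sol N gamma (S b) 0).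
  { intros b. rewrite Hb, lattice_sol_0_l, lattice_sol_0_r by auto. ring. }
  assert (Hr : forall a, w (S a) 0%nat
    = lattice_sol N beta (S a) 0 + lattice_sol N gamma 0 (S a)).
  { intros a. rewrite Hg, lattice_sol_0_l, lattice_sol_0_r by auto. ring. }
  assert (Hstep : forall a b,
    w a (S b) = lattice_sol N beta a (S b) + lattice_sol N gamma (S b) a ->
    w (S a) b = lattice_sol N beta (S a) b + lattice_sol N gamma b (S a) ->
    w (S a) (S b)
    = lattice_sol N beta (S a) (S b) + lattice_sol N gamma (S b) (S a)).
  { intros a b E1 E2. apply (Rmult_eq_reg_l N); auto.
    rewrite Rmult_plus_distr_l, Hrec, E1, E2, !lattice_sol_rec by auto. ring. }
  intros a. induction a as [|a IHa]; intros b.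
  - induction b as [|b IHb]; apply Hstep; auto.
  - induction b as [|b IHb]; apply Hstep; auto.
Qed.

(** The two families of summands come from the poles at [t = y] and [t = - x]
    of [(x + t) ^ (- q - 1) * (y - t) ^ (- q - 1)]. *)
Lemma two_poles_partial_fractions (x y : R) (r q : nat) :
  x <> 0 -> y <> 0 -> x + y <> 0 ->
  two_poles_coef x y r (S q) (S q)
  = sum_add_eq q (fun i j =>
      multichoose (S r) i * multichoose (S q) j / (x + y) ^ (S q + j)
      * (/ y ^ (S r + i) + (-1) ^ r * / x ^ (S r + i))).
Proof.
  intros Hx Hy HN.
  set (ax := fun (z s : R) k =>
    match k with O => 0 | S _ => s * pole_coef z k r end).
  rewrite (lattice_sol_unique (x + y) (ax y 1) (ax x ((-1) ^ r))
    (two_poles_coef x y r)); auto.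
  - unfold lattice_sol. rewrite <- sum_add_eq_plus, sum_add_eq_Sr.
    rewrite (sum_add_eq_swap q (fun i j => multichoose (S r) i * _ / _ * _)).
    simpl ax at 1 2. rewrite !Rmult_0_r, !Rplus_0_l.
    apply sum_add_eq_ext. intros j i _. unfold ax, pole_coef.
    rewrite (multichoose_sym i r).
    replace (S i + r)%nat with (S r + i)%nat by lia.
    field. repeat split; now apply pow_nonzero.
  - intros a b. now apply two_poles_coef_rec.
  - intros b. rewrite two_poles_coef_0_l. simpl. ring.
  - intros a. rewrite two_poles_coef_0_r. simpl. ring.
Qed.

(** * Series of real numbers *)

Lemma is_series_scal_R (c : R) (u : nat -> R) (l : R) :
  is_series u l -> is_series (fun k => c * u k) (c * l).
Proof. apply (is_series_scal_l c u l). Qed.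

Lemma is_series_plus_R (u v : nat -> R) (l m : R) :
  is_series u l -> is_series v m -> is_series (fun k => u k + v k) (l + m).
Proof. apply (is_series_plus u v l m). Qed.

Lemma is_series_eq (u v : nat -> R) (l m : R) :
  (forall k, u k = v k) -> l = m -> is_series u l -> is_series v m.
Proof. intros H -> Hu. now apply (is_series_ext u). Qed.

Lemma is_series_sum_add_eq (n : nat) (F : nat -> nat -> nat -> R)
    (l : nat -> nat -> R) :
  (forall i j, (i + j = n)%nat -> is_series (F i j) (l i j)) ->
  is_series (fun k => sum_add_eq n (fun i j => F i j k)) (sum_add_eq n l).
Proof.
  revert F l. induction n as [|n IH]; intros F l H.
  - rewrite sum_add_eq_0.
    apply (is_series_ext (F 0%nat 0%nat)); [|now apply H].
    intros k. now rewrite sum_add_eq_0.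
  - rewrite sum_add_eq_Sl.
    apply (is_series_ext (fun k => F 0%nat (S n) k
      + sum_add_eq n (fun i j => F (S i) j k))).
    + intros k. now rewrite sum_add_eq_Sl.
    + apply is_series_plus_R; [apply H; lia|].
      apply (IH (fun i j => F (S i) j)). intros i j Hij. apply H. lia.
Qed.

Lemma ex_series_nonneg_le (u v : nat -> R) :
  (forall k, 0 <= u k <= v k) -> ex_series v -> ex_series u.
Proof.
  intros H Hv. apply (ex_series_le u v); auto.
  intros k. unfold norm; simpl; unfold abs; simpl.
  rewrite Rabs_pos_eq; apply H.
Qed.

Lemma ex_series_bounded (u : nat -> R) (M : R) :
  (forall k, 0 <= u k) -> (forall n, sum_n u n <= M) -> ex_series u.
Proof.
  intros Hu HM.
  destruct (ex_finite_lim_seq_incr (sum_n u) M) as [l Hl]; auto.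
  - intros n. rewrite sum_n_Sr. specialize (Hu (S n)). lra.
  - now exists l.
Qed.

Lemma sum_n_le_is_series (u : nat -> R) (l : R) (n : nat) :
  (forall k, 0 <= u k) -> is_series u l -> sum_n u n <= l.
Proof.
  intros Hu Hl. rewrite sum_n_Reals. apply sum_incr; auto.
  apply is_series_Reals in Hl. exact Hl.
Qed.

Lemma is_series_cauchy_product (u v : nat -> R) (l m : R) :
  (forall k, 0 <= u k) -> (forall k, 0 <= v k) ->
  is_series u l -> is_series v m ->
  is_series (fun n => sum_add_eq n (fun i j => u i * v j)) (l * m).
Proof.
  intros Hu Hv Hl Hm.
  apply (is_series_ext (fun n => sum_f_R0 (fun k => u k * v (n - k)%nat) n)).
  - intros n. symmetry. apply sum_n_Reals.
  - now apply is_series_mult_pos.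
Qed.

Definition sum_before (u : nat -> R) (n : nat) : R :=
  match n with O => 0 | S m => sum_n u m end.

Lemma sum_before_bounds (u : nat -> R) (l : R) (n : nat) :
  (forall k, 0 <= u k) -> is_series u l -> 0 <= sum_before u n <= l.
Proof.
  intros Hu Hl. pose proof (sum_n_le_is_series u l 0 Hu Hl) as H0.
  rewrite sum_O in H0. pose proof (Hu 0%nat).
  destruct n as [|n]; simpl; [lra|]. split.
  - apply sum_n_nonneg. auto.
  - now apply sum_n_le_is_series.
Qed.

Lemma ex_series_sum_before (u v : nat -> R) (l m : R) :
  (forall k, 0 <= u k) -> (forall k, 0 <= v k) ->
  is_series u l -> is_series v m ->
  ex_series (fun n => sum_before u n * v n).
Proof.
  intros Hu Hv Hl Hm. apply (ex_series_nonneg_le _ (fun n => l * v n)).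
  - intros n. pose proof (sum_before_bounds u l n Hu Hl). split.
    + now apply Rmult_le_pos.
    + now apply Rmult_le_compat_r.
  - exists (l * m). now apply is_series_scal_R.
Qed.

(** The products [u i * v j] with [i < j], with [i > j] and with [i = j] make up
    the square, at the level of partial sums. *)
Lemma series_mult_diagonal (u v w : nat -> R) (l m d : R) :
  (forall k, 0 <= u k) -> (forall k, 0 <= v k) ->
  (forall k, w k = u k * v k) ->
  is_series u l -> is_series v m -> is_series w d ->
  Series (fun n => sum_before u n * v n) + Series (fun n => sum_before v n * u n)
  = l * m - d.
Proof.
  intros Hu Hv Hw Hl Hm Hd.
  pose proof (Series_correct _ (ex_series_sum_before u v l m Hu Hv Hl Hm)) as Huv.
  pose proof (Series_correct _ (ex_series_sum_before v u m l Hv Hu Hm Hl)) as Hvu.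
  pose proof (is_series_plus_R _ _ _ _ (is_series_plus_R _ _ _ _ Huv Hvu) Hd) as H.
  assert (Hp : is_series (fun k => sum_before u k * v k + sum_before v k * u k + w k)
                 (l * m)).
  { match goal with
    | |- is_series ?s ?t => change (is_lim_seq (sum_n s) t)
    end.
    apply (is_lim_seq_ext (fun n => sum_n u n * sum_n v n)).
    - intros n. induction n as [|n IH].
      + rewrite !sum_O, Hw. simpl. ring.
      + rewrite !sum_n_Sr, <- IH, Hw. simpl. ring.
    - apply is_lim_seq_mult'; [exact Hl | exact Hm]. }
  apply is_series_unique in H. apply is_series_unique in Hp. lra.
Qed.

(** * Sums over the half-integers *)

Definition half_int (k : nat) : R := INR k + / 2.

Lemma half_int_pos (k : nat) : 0 < half_int k.
Proof. unfold half_int. pose proof (pos_INR k). lra. Qed.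

Lemma inv_half_int_pow_pos (s k : nat) : 0 < / half_int k ^ s.
Proof. apply Rinv_0_lt_compat, pow_lt, half_int_pos. Qed.

Lemma inv_half_int_pow_nonneg (s k : nat) : 0 <= / half_int k ^ s.
Proof. left. apply inv_half_int_pow_pos. Qed.

Lemma inv_half_int_le (k : nat) : / half_int k <= 2.
Proof.
  rewrite <- (Rinv_inv 2). apply Rinv_le_contravar; [lra|].
  unfold half_int. pose proof (pos_INR k). lra.
Qed.

Lemma half_int_shift (k : nat) : INR (S k) - 1 / 2 = half_int k.
Proof. unfold half_int. rewrite S_INR. lra. Qed.

Lemma half_int_plus (m n : nat) :
  half_int m + half_int n = INR (S (m + n)).
Proof. unfold half_int. rewrite S_INR, plus_INR. lra. Qed.

(** Telescoping: [1 / (k + 1/2) ^ 2 <= 1 / k - 1 / (k + 1)] for [k >= 1]. *)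
Lemma ex_series_inv_half_int_sq : ex_series (fun k => / half_int k ^ 2).
Proof.
  apply (ex_series_bounded _ 5); [intros; apply inv_half_int_pow_nonneg|].
  enough (forall n, sum_n (fun k => / half_int k ^ 2) n <= 5 - / INR (S n)).
  { intros n. specialize (H n).
    pose proof (Rinv_0_lt_compat (INR (S n)) (lt_0_INR _ (Nat.lt_0_succ n))). lra. }
  induction n as [|n IH].
  - rewrite sum_O. unfold half_int. simpl. lra.
  - rewrite sum_n_Sr.
    enough (/ half_int (S n) ^ 2 <= / INR (S n) - / INR (S (S n))) by lra.
    unfold half_int. rewrite (S_INR (S n)).
    pose proof (lt_0_INR (S n) (Nat.lt_0_succ n)) as Hz.
    set (z := INR (S n)) in *.
    replace (/ z - / (z + 1)) with (/ (z * (z + 1))) by (field; lra).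
    apply Rinv_le_contravar; [|simpl]; nra.
Qed.

Lemma is_series_t_tilde (s : nat) : (2 <= s)%nat ->
  is_series (fun k => / half_int k ^ s) (t_tilde s).
Proof.
  intros Hs. unfold t_tilde, series1.
  rewrite (Series_ext _ (fun k => / half_int k ^ s))
    by (intros k; rewrite half_int_shift; unfold Rdiv; ring).
  apply Series_correct. induction Hs as [|s Hs IH].
  - apply ex_series_inv_half_int_sq.
  - apply (ex_series_nonneg_le _ (fun k => 2 * / half_int k ^ s)).
    + intros k. split; [apply inv_half_int_pow_nonneg|].
      simpl. rewrite Rinv_mult.
      apply Rmult_le_compat_r; [apply inv_half_int_pow_nonneg | apply inv_half_int_le].
    + destruct IH as [l Hl]. exists (2 * l). now apply is_series_scal_R.
Qed.

Lemma h_eq (r n : nat) : h r n = sum_before (fun k => / half_int k ^ r) n.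
Proof.
  unfold h. destruct n as [|n].
  - exact (sum_n_m_zero (G := R_AbelianMonoid) _ 1 0 Nat.lt_0_1).
  - rewrite <- sum_n_m_S. apply sum_n_eq. intros k _.
    rewrite half_int_shift. unfold Rdiv. apply Rmult_1_l.
Qed.

(** * The sums [T] *)

Lemma T_stuffle (a b : nat) : (2 <= a)%nat -> (2 <= b)%nat ->
  T a b + T b a = t_tilde a * t_tilde b - t_tilde (a + b).
Proof.
  intros Ha Hb.
  assert (HT : forall c d, T c d = Series (fun k =>
    sum_before (fun k => / half_int k ^ c) k * / half_int k ^ d)).
  { intros c d. apply Series_ext. intros k.
    now rewrite half_int_shift, h_eq, Nat.sub_succ, Nat.sub_0_r. }
  rewrite !HT.
  apply (series_mult_diagonal _ _ (fun k => / half_int k ^ (a + b)));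
    try (apply is_series_t_tilde; lia); try (intros; apply inv_half_int_pow_nonneg).
  intros k. now rewrite pow_add, Rinv_mult.
Qed.

(** The coefficients are symmetric in [i] and [j], so that [T_stuffle] applies
    to the sum and its mirror image. *)
Lemma T_sum (q r : nat) : (2 <= q)%nat ->
  2 * sum_add_eq r (fun i j =>
        multichoose q i * multichoose q j * T (q + i) (q + j))
  = sum_add_eq r (fun i j =>
        multichoose q i * multichoose q j * (t_tilde (q + i) * t_tilde (q + j)))
    - multichoose (2 * q) r * t_tilde (2 * q + r).
Proof.
  intros Hq. set (f := fun i j => _ * _ * T _ _).
  replace (2 * sum_add_eq r f)
    with (sum_add_eq r f + sum_add_eq r (fun i j => f j i))
    by (rewrite <- (sum_add_eq_swap r f); ring).
  replace (2 * q)%nat with (q + q)%nat by lia.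
  rewrite <- sum_add_eq_plus, <- multichoose_vandermonde, Rmult_comm.
  rewrite <- sum_add_eq_scal, <- sum_add_eq_minus.
  apply sum_add_eq_ext. intros i j Hij. unfold f.
  transitivity (multichoose q i * multichoose q j
    * (T (q + i) (q + j) + T (q + j) (q + i))); [ring|].
  rewrite T_stuffle by lia.
  replace (q + i + (q + j))%nat with (q + q + r)%nat by lia. ring.
Qed.

(** * The sums [S_tilde] *)

Lemma sum_add_eq_exchange (n m : nat) (f : nat -> nat -> nat -> nat -> R) :
  sum_add_eq n (fun i j => sum_add_eq m (f i j))
  = sum_add_eq m (fun k l => sum_add_eq n (fun i j => f i j k l)).
Proof. exact (sum_n_sum_add_eq m n (fun i => f i (n - i)%nat)). Qed.

Lemma sum_add_eq_fst (u : nat -> R) (n : nat) :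
  sum_add_eq n (fun i _ => u i) = sum_n u n.
Proof. easy. Qed.

(** Sum [two_poles_partial_fractions] over the pairs of half-integers [x], [y]
    with [x + y = N + 1]. For [r] even, both poles contribute the same. *)
Lemma S_tilde_term (q r N : nat) : Nat.Even r ->
  2 * sum_add_eq q (fun i j => multichoose (S r) i * multichoose (S q) j
        * (h (S r + i) (S N) / INR (S N) ^ (S q + j)))
  = sum_add_eq r (fun i j => (-1) ^ i * multichoose (S q) i * multichoose (S q) j
        * sum_add_eq N (fun m n => / half_int m ^ (S q + i)
                                   * / half_int n ^ (S q + j))).
Proof.
  intros Hr.
  transitivity (sum_add_eq N (fun m n =>
    two_poles_coef (half_int m) (half_int n) r (S q) (S q))).
  - rewrite (sum_add_eq_ext N _ (fun m n => sum_add_eq q (fun i j =>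
      multichoose (S r) i * multichoose (S q) j / INR (S N) ^ (S q + j)
      * (/ half_int n ^ (S r + i) + / half_int m ^ (S r + i))))).
    + rewrite sum_add_eq_exchange, <- sum_add_eq_scal.
      apply sum_add_eq_ext. intros i j _.
      rewrite sum_add_eq_scal, sum_add_eq_plus.
      rewrite (sum_add_eq_swap N (fun m n => / half_int n ^ _)).
      rewrite sum_add_eq_fst, h_eq. cbn [sum_before]. unfold Rdiv. ring.
    + intros m n Hmn.
      pose proof (half_int_pos m). pose proof (half_int_pos n).
      rewrite two_poles_partial_fractions by lra.
      rewrite half_int_plus, Hmn.
      destruct Hr as [k ->]. rewrite pow_1_even.
      apply sum_add_eq_ext. intros i j _. ring.
  - unfold two_poles_coef. rewrite sum_add_eq_exchange.
    apply sum_add_eq_ext. intros i j _.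
    rewrite <- sum_add_eq_scal. apply sum_add_eq_ext. intros m n _.
    unfold pole_coef, Rdiv. ring.
Qed.

(** Sum [S_tilde_term] over [N]: its right-hand side is a combination of Cauchy
    products. *)
Lemma S_tilde_sum (q r : nat) : (1 <= q)%nat -> Nat.Even r ->
  2 * sum_add_eq q (fun i j => multichoose (S r) i * multichoose (S q) j
        * S_tilde (S r + i) (S q + j))
  = sum_add_eq r (fun i j => (-1) ^ i * multichoose (S q) i * multichoose (S q) j
        * (t_tilde (S q + i) * t_tilde (S q + j))).
Proof.
  intros Hq Hr.
  set (term := fun i j N => multichoose (S r) i * multichoose (S q) j
    * (h (S r + i) (S N) / INR (S N) ^ (S q + j))).
  set (rhs := sum_add_eq r _).
  assert (Hsum : is_series (fun N => 2 * sum_add_eq q (fun i j => term i j N)) rhs).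
  { apply (is_series_ext (fun N => sum_add_eq r (fun i j =>
      (-1) ^ i * multichoose (S q) i * multichoose (S q) j
        * sum_add_eq N (fun m n => / half_int m ^ (S q + i)
                                   * / half_int n ^ (S q + j))))).
    { intros N. symmetry. now apply S_tilde_term. }
    apply (is_series_sum_add_eq r (fun i j N => _)). intros i j _.
    apply is_series_scal_R. apply is_series_cauchy_product;
      try (intros; apply inv_half_int_pow_nonneg);
      apply is_series_t_tilde; lia. }
  assert (Hpos : forall i j N, 0 <= term i j N).
  { intros i j N. unfold term. rewrite h_eq. apply Rmult_le_pos.
    - apply Rmult_le_pos; apply multichoose_nonneg.
    - apply Rmult_le_pos; [apply sum_n_nonneg; intros; apply inv_half_int_pow_nonneg|].
      left. apply Rinv_0_lt_compat, pow_lt, lt_0_INR. lia. }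
  (* All terms being nonnegative, each of the series converges with the total. *)
  assert (Hex : forall i j, (i + j = q)%nat -> ex_series (term i j)).
  { intros i j Hij.
    apply (ex_series_nonneg_le _ (fun N => 2 * sum_add_eq q (fun i j => term i j N)));
      [|now exists rhs].
    intros N. split; [apply Hpos|].
    pose proof (sum_add_eq_ge q i j (fun i j => term i j N)
      (fun a b => Hpos a b N) Hij).
    pose proof (Hpos i j N). simpl in *. lra. }
  rewrite <- (is_series_unique _ _ Hsum), Series_scal_l. f_equal.
  symmetry. apply is_series_unique.
  apply (is_series_sum_add_eq q term). intros i j Hij.
  replace (_ * _ * S_tilde _ _) with (Series (term i j)).
  - apply Series_correct; auto.
  - unfold term. now rewrite Series_scal_l.
Qed.

(** * The convolution of the even values *)

Definition t_even (n : nat) : R := t_tilde (2 * n + 2).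

Lemma geometric_sum (a b : R) (n : nat) :
  (a - b) * sum_add_eq n (fun i j => a ^ i * b ^ j) = a ^ S n - b ^ S n.
Proof.
  induction n as [|n IH]; [rewrite sum_add_eq_0; simpl; ring|].
  rewrite sum_add_eq_Sl.
  rewrite (sum_add_eq_ext n _ (fun i j => a * (a ^ i * b ^ j)))
    by (intros; simpl; ring).
  rewrite sum_add_eq_scal.
  transitivity ((a - b) * b ^ S n
    + a * ((a - b) * sum_add_eq n (fun i j => a ^ i * b ^ j))); [simpl; ring|].
  rewrite IH. simpl. ring.
Qed.

Lemma geometric_sum_diag (a : R) (n : nat) :
  sum_add_eq n (fun i j => a ^ i * a ^ j) = INR (S n) * a ^ n.
Proof.
  rewrite (sum_add_eq_ext n _ (fun _ _ => a ^ n)).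
  - exact (sum_n_const n (a ^ n)).
  - intros i j <-. now rewrite pow_add.
Qed.

(** Since [/ 0 = 0], this is [0] for [m = l], so that sums over [l <> m] can be
    written as sums over all [l]. *)
Definition gap_inv (m l : nat) : R := / (half_int l ^ 2 - half_int m ^ 2).

Lemma gap_inv_anti (m l : nat) : gap_inv l m = - gap_inv m l.
Proof. unfold gap_inv. rewrite <- Rinv_opp. f_equal. ring. Qed.

Lemma half_int_sq_neq (m l : nat) : m <> l ->
  half_int l ^ 2 - half_int m ^ 2 <> 0.
Proof.
  intros Hml. pose proof (not_INR _ _ Hml).
  pose proof (pos_INR m). pose proof (pos_INR l). unfold half_int.
  replace (_ - _) with ((INR l - INR m) * (INR l + INR m + 1)) by field.
  apply Rmult_integral_contrapositive; split; lra.
Qed.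

(** For [a = 1 / x_m^2] and [b = 1 / x_l^2], the factor [a * b / (a - b)] of the
    geometric sum is [1 / (x_l^2 - x_m^2)]. *)
Lemma inv_sq_geometric_sum (n m l : nat) :
  sum_add_eq n (fun i j => (/ half_int m ^ 2) ^ S i * (/ half_int l ^ 2) ^ S j)
  = ((/ half_int m ^ 2) ^ S n - (/ half_int l ^ 2) ^ S n) * gap_inv m l
    + (if (m =? l)%nat then INR (S n) * (/ half_int m ^ 2) ^ S (S n) else 0).
Proof.
  set (a := / half_int m ^ 2). set (b := / half_int l ^ 2).
  rewrite (sum_add_eq_ext n _ (fun i j => (a * b) * (a ^ i * b ^ j)))
    by (intros; simpl; ring).
  rewrite sum_add_eq_scal.
  destruct (Nat.eqb_spec m l) as [E|Hml].
  - unfold b, a. rewrite <- E, geometric_sum_diag. simpl pow. ring.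
  - rewrite <- geometric_sum, Rplus_0_r.
    pose proof (half_int_sq_neq m l Hml).
    pose proof (half_int_pos m). pose proof (half_int_pos l).
    unfold gap_inv.
    replace (a * b) with ((a - b) / (half_int l ^ 2 - half_int m ^ 2))
      by (unfold a, b; field; repeat split; lra).
    unfold Rdiv. ring.
Qed.

(** [H_(M-m) - H_(M+m+1)], where [H_n] is the n-th harmonic number: again
    [/ 0 = 0] removes the term [l = m] of the first part. *)
Definition harmonic_gap (M m : nat) : R :=
  sum_n (fun l => / (INR l - INR m) - / (INR l + INR m + 1)) M.

Lemma sum_n_telescope (f : nat -> R) (n : nat) :
  sum_n (fun k => f (S k) - f k) n = f (S n) - f 0%nat :> R.
Proof.
  induction n as [|n IH]; [now rewrite sum_O|]. rewrite sum_n_Sr, IH. ring.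
Qed.

Lemma harmonic_gap_0 (M : nat) : harmonic_gap M 0 = - / INR (S M).
Proof.
  unfold harmonic_gap. induction M as [|M IH].
  - rewrite sum_O. simpl. rewrite Rminus_0_r, Rinv_0. rewrite !Rplus_0_l. ring.
  - rewrite sum_n_Sr, IH. simpl (INR 0). rewrite (S_INR (S M)).
    rewrite Rminus_0_r, Rplus_0_r. ring.
Qed.

Lemma harmonic_gap_S (M m : nat) :
  harmonic_gap M (S m)
  = harmonic_gap M m - (/ (INR M - INR m) + / (INR M + INR m + 2)).
Proof.
  set (f := fun l => / (INR l - INR (S m)) + / (INR l + INR m + 1)).
  enough (harmonic_gap M m - harmonic_gap M (S m)
          = / (INR M - INR m) + / (INR M + INR m + 2)) by lra.
  unfold harmonic_gap. rewrite <- sum_n_minus_R.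
  rewrite (sum_n_eq _ (fun l => f (S l) - f l)).
  - rewrite sum_n_telescope. unfold f. rewrite !S_INR. simpl (INR 0).
    rewrite !Rminus_0_l, !Rplus_0_l, Rinv_opp.
    replace (INR M + 1 - (INR m + 1)) with (INR M - INR m) by ring.
    replace (INR M + 1 + INR m + 1) with (INR M + INR m + 2) by ring. ring.
  - intros l _. unfold f. rewrite !S_INR.
    replace (INR l + 1 - (INR m + 1)) with (INR l - INR m) by ring.
    replace (INR l + (INR m + 1) + 1) with (INR l + 1 + INR m + 1) by ring. ring.
Qed.

(** The difference of harmonic numbers consists of [2 m + 1] terms, each at most
    [1 / (M + 1 - m)]. *)
Lemma harmonic_gap_bound (M m : nat) : (m <= M)%nat ->
  Rabs (harmonic_gap M m) <= 2 * half_int m / INR (S M - m).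
Proof.
  intros Hm.
  enough (0 <= - harmonic_gap M m <= 2 * half_int m / INR (S M - m)) as H.
  { rewrite <- Rabs_Ropp, Rabs_pos_eq; apply H. }
  induction m as [|m IH].
  - rewrite harmonic_gap_0, Ropp_involutive, Nat.sub_0_r.
    pose proof (Rinv_0_lt_compat _ (lt_0_INR (S M) (Nat.lt_0_succ M))).
    unfold half_int. simpl (INR 0). split; [lra|]. unfold Rdiv.
    rewrite Rplus_0_l, Rinv_r, Rmult_1_l; lra.
  - specialize (IH ltac:(lia)). rewrite harmonic_gap_S.
    replace (S M - S m)%nat with (M - m)%nat by lia.
    rewrite (minus_INR (S M) m) in IH by lia.
    rewrite (minus_INR M m) by lia. rewrite S_INR in IH.
    assert (HmM : INR m + 1 <= INR M) by (rewrite <- S_INR; now apply le_INR).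
    pose proof (pos_INR m) as Hm0. unfold half_int in *. rewrite S_INR.
    assert (H1 : 0 < / (INR M + INR m + 2) <= / (INR M - INR m)).
    { split; [apply Rinv_0_lt_compat; lra|].
      apply Rinv_le_contravar; lra. }
    assert (H2 : 2 * (INR m + / 2) / (INR M + 1 - INR m)
                 <= (2 * INR m + 1) * / (INR M - INR m)).
    { replace (2 * (INR m + / 2)) with (2 * INR m + 1) by field.
      apply Rmult_le_compat_l; [lra|]. apply Rinv_le_contravar; lra. }
    unfold Rdiv at 1. split; [lra|].
    replace (2 * (INR m + 1 + / 2)) with (2 * INR m + 1 + 2) by field. lra.
Qed.

(** With [x_l = half_int l], [1 / (x_l^2 - x_m^2)] is
    [(1 / (x_l - x_m) - 1 / (x_l + x_m)) / (2 x_m)] for [l <> m]. The summand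
    [/ half_int m ^ 2 / 4] makes up for [l = m], where the second fraction
    remains in [harmonic_gap]. *)
Lemma gap_inv_sum (M m : nat) : (m <= M)%nat ->
  sum_n (gap_inv m) M
  = / half_int m ^ 2 / 4 + harmonic_gap M m / (2 * half_int m) :> R.
Proof.
  intros Hm. pose proof (half_int_pos m) as Hx.
  rewrite (sum_n_eq _ (fun l =>
    (if (m =? l)%nat then / half_int m ^ 2 / 4 else 0)
    + (/ (INR l - INR m) - / (INR l + INR m + 1)) * / (2 * half_int m))).
  - rewrite sum_n_plus_R, (sum_n_delta (fun _ => _)), sum_n_scal_r by auto.
    reflexivity.
  - intros l _. destruct (Nat.eqb_spec m l) as [<-|Hml].
    + unfold gap_inv. rewrite !Rminus_diag, Rinv_0.
      replace (INR m + INR m + 1) with (2 * half_int m)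
        by (unfold half_int; field).
      field. lra.
    + pose proof (half_int_sq_neq m l Hml). pose proof (not_INR _ _ Hml).
      pose proof (pos_INR m). pose proof (pos_INR l).
      unfold gap_inv.
      replace (half_int l ^ 2 - half_int m ^ 2)
        with ((INR l - INR m) * (INR l + INR m + 1)) by (unfold half_int; field).
      unfold half_int. field. repeat split; lra.
Qed.

(** Sum [inv_sq_geometric_sum] over the square [m, l <= M]. As [gap_inv] is
    antisymmetric, the two halves of the off-diagonal part agree; its row sums
    are given by [gap_inv_sum]. *)
Lemma square_sum (n M : nat) :
  sum_add_eq n (fun i j => sum_n (fun m => (/ half_int m ^ 2) ^ S i) M
                           * sum_n (fun l => (/ half_int l ^ 2) ^ S j) M)
  = (INR n + 3 / 2) * sum_n (fun m => (/ half_int m ^ 2) ^ S (S n)) M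
    + sum_n (fun m => (/ half_int m ^ 2) ^ S n * / half_int m
                      * harmonic_gap M m) M.
Proof.
  set (A := fun m => / half_int m ^ 2).
  transitivity (sum_n (fun m => sum_n (fun l =>
    sum_add_eq n (fun i j => A m ^ S i * A l ^ S j)) M) M).
  { rewrite (sum_n_eq _ (fun m => sum_add_eq n (fun i j =>
      sum_n (fun l => A m ^ S i * A l ^ S j) M)))
      by (intros; apply sum_n_sum_add_eq).
    rewrite sum_n_sum_add_eq. apply sum_add_eq_ext. intros i j _.
    rewrite <- sum_n_scal_r. apply sum_n_eq. intros m _.
    now rewrite <- sum_n_scal. }
  rewrite (sum_n_eq _ (fun m =>
    (A m ^ S n * sum_n (gap_inv m) M
     + sum_n (fun l => A l ^ S n * gap_inv l m) M)
    + INR (S n) * A m ^ S (S n))).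
  2:{ intros m Hm.
    rewrite (sum_n_eq _ (fun l => (A m ^ S n * gap_inv m l + A l ^ S n * gap_inv l m)
      + (if (m =? l)%nat then INR (S n) * A m ^ S (S n) else 0))).
    - now rewrite !sum_n_plus_R, sum_n_scal, (sum_n_delta (fun _ => _)).
    - intros l _. unfold A. rewrite inv_sq_geometric_sum, (gap_inv_anti m l). ring. }
  rewrite !sum_n_plus_R, sum_n_scal.
  rewrite (sum_n_switch (fun m l => A l ^ S n * gap_inv l m)).
  rewrite (sum_n_eq (fun j => sum_n (fun i => A j ^ S n * gap_inv j i) M)
    (fun m => A m ^ S n * sum_n (gap_inv m) M))
    by (intros; apply sum_n_scal).
  rewrite (sum_n_eq (fun m => A m ^ S n * sum_n (gap_inv m) M)
    (fun m => / 4 * A m ^ S (S n)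
              + / 2 * (A m ^ S n * / half_int m * harmonic_gap M m))).
  - rewrite sum_n_plus_R, !sum_n_scal, S_INR. unfold A. cbv beta. field.
  - intros m Hm. rewrite gap_inv_sum by auto. fold (A m).
    pose proof (half_int_pos m). simpl pow. field. lra.
Qed.

(** With [x = half_int m] and [y = S M - m], two partial fraction steps give
    [1 / (x^2 y) = (1 / x^2 + (1 / x + 1 / y) / (x + y)) / (x + y)]. Here
    [x >= 1/2], [y >= 1], and [x + y] is at least the number of terms. *)
Lemma sum_inv_sq_mult_small (M : nat) :
  sum_n (fun m => / half_int m ^ 2 * / INR (S M - m)) M
  <= (t_tilde 2 + 3) / INR (S M).
Proof.
  set (N := INR (S M)). assert (HN : 0 < N) by (apply lt_0_INR; lia).
  apply Rle_trans with
    (sum_n (fun m => / N * (/ half_int m ^ 2 + 3 * / N)) M).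
  - apply sum_n_le. intros m Hm.
    rewrite minus_INR by lia. fold N.
    assert (HmN : INR m + 1 <= N)
      by (unfold N; rewrite S_INR; apply le_INR in Hm; lra).
    pose proof (pos_INR m) as Hm0.
    set (x := half_int m). set (y := N - INR m).
    assert (Hx : / 2 <= x) by (unfold x, half_int; lra).
    assert (Hy : 1 <= y) by (unfold y; lra).
    assert (Hxy : N = x + y - / 2) by (unfold x, y, half_int; lra).
    assert (HNx : / (x + y) <= / N) by (apply Rinv_le_contravar; lra).
    assert (Hx2 : 0 < / x ^ 2) by (apply Rinv_0_lt_compat, pow_lt; lra).
    assert (Hx1 : 0 < / x <= 2).
    { split; [apply Rinv_0_lt_compat; lra|].
      rewrite <- (Rinv_inv 2). apply Rinv_le_contravar; lra. }
    assert (Hy1 : 0 < / y <= 1).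
    { split; [apply Rinv_0_lt_compat; lra|].
      rewrite <- Rinv_1. apply Rinv_le_contravar; lra. }
    assert (Hs : 0 < / (x + y)) by (apply Rinv_0_lt_compat; lra).
    replace (/ x ^ 2 * / y)
      with (/ (x + y) * (/ x ^ 2 + (/ x + / y) * / (x + y)))
      by (field; lra).
    apply Rmult_le_compat; try lra.
    + apply Rplus_le_le_0_compat; [lra|]. apply Rmult_le_pos; lra.
    + apply Rplus_le_compat_l. apply Rmult_le_compat; lra.
  - rewrite sum_n_scal, sum_n_plus_R, sum_n_const. fold N.
    pose proof (sum_n_le_is_series _ _ M (inv_half_int_pow_nonneg 2)
      (is_series_t_tilde 2 (le_n 2))).
    unfold Rdiv. rewrite Rmult_comm. apply Rmult_le_compat_r.
    + left. now apply Rinv_0_lt_compat.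
    + replace (N * (3 * / N)) with 3 by (field; lra). lra.
Qed.

Lemma is_lim_seq_sum_add_eq (n : nat) (F : nat -> nat -> nat -> R)
    (l : nat -> nat -> R) :
  (forall i j, is_lim_seq (F i j) (l i j)) ->
  is_lim_seq (fun k => sum_add_eq n (fun i j => F i j k)) (sum_add_eq n l).
Proof.
  revert F l. induction n as [|n IH]; intros F l H.
  - rewrite sum_add_eq_0. apply (is_lim_seq_ext (F 0%nat 0%nat)); auto.
    intros k. now rewrite sum_add_eq_0.
  - rewrite sum_add_eq_Sl.
    apply (is_lim_seq_ext (fun k => F 0%nat (S n) k
      + sum_add_eq n (fun i j => F (S i) j k))).
    + intros k. now rewrite sum_add_eq_Sl.
    + apply is_lim_seq_plus'; [apply H|].
      apply (IH (fun i j => F (S i) j)). intros i j. apply H.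
Qed.

Lemma is_lim_seq_t_even (n : nat) :
  is_lim_seq (sum_n (fun m => (/ half_int m ^ 2) ^ S n)) (t_even n).
Proof.
  apply (is_lim_seq_ext (sum_n (fun m => / half_int m ^ (2 * n + 2)))).
  - intros M. apply sum_n_eq. intros m _.
    rewrite pow_inv, <- pow_mult. do 2 f_equal. lia.
  - apply (is_series_t_tilde (2 * n + 2)). lia.
Qed.

(** Let [M] grow in [square_sum]; the harmonic sums disappear in the limit. *)
Lemma t_even_convolution (n : nat) :
  sum_add_eq n (fun i j => t_even i * t_even j)
  = (INR n + 3 / 2) * t_even (S n).
Proof.
  set (err := fun M => sum_n (fun m => (/ half_int m ^ 2) ^ S n * / half_int m
    * harmonic_gap M m) M : R).
  assert (Herr : is_lim_seq err 0).
  { set (C := 2 * 4 ^ n * (t_tilde 2 + 3)).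
    assert (Hb : forall M, Rabs (err M) <= C * / INR (S M)).
    { intros M. unfold err.
      eapply Rle_trans; [rewrite sum_n_Reals; apply Rsum_abs|].
      rewrite <- sum_n_Reals.
      apply Rle_trans with (sum_n (fun m => 2 * 4 ^ n *
        (/ half_int m ^ 2 * / INR (S M - m))) M).
      - apply sum_n_le. intros m Hm.
        pose proof (half_int_pos m) as Hx.
        pose proof (inv_half_int_pow_pos 2 m) as Ha.
        set (a := / half_int m ^ 2) in *.
        assert (Ha4 : a ^ n <= 4 ^ n).
        { apply pow_incr. split; [lra|].
          unfold a. rewrite <- pow_inv.
          replace 4 with (2 ^ 2) by ring. apply pow_incr. split.
          - left. now apply Rinv_0_lt_compat.
          - apply inv_half_int_le. }
        rewrite !Rabs_mult, (Rabs_pos_eq (a ^ S n)) by (apply pow_le; lra).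
        rewrite (Rabs_pos_eq (/ half_int m))
          by (left; now apply Rinv_0_lt_compat).
        pose proof (harmonic_gap_bound M m Hm) as Hg.
        apply Rle_trans with (a ^ S n * / half_int m
          * (2 * half_int m / INR (S M - m))).
        + apply Rmult_le_compat_l; [|exact Hg].
          apply Rmult_le_pos; [apply pow_le; lra|].
          left. now apply Rinv_0_lt_compat.
        + assert (HMm : 0 < INR (S M - m)) by (apply lt_0_INR; lia).
          replace (a ^ S n * / half_int m * (2 * half_int m / INR (S M - m)))
            with (a ^ n * (2 * (a * / INR (S M - m)))) by (cbn [pow]; field; lra).
          replace (2 * 4 ^ n * (a * / INR (S M - m)))
            with (4 ^ n * (2 * (a * / INR (S M - m)))) by ring.
          apply Rmult_le_compat_r; [|exact Ha4].
          apply Rmult_le_pos; [lra|]. apply Rmult_le_pos; [lra|].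
          left. now apply Rinv_0_lt_compat.
      - rewrite sum_n_scal. unfold C. rewrite (Rmult_assoc (2 * 4 ^ n)).
        apply Rmult_le_compat_l.
        + apply Rmult_le_pos; [lra|]. apply pow_le. lra.
        + apply sum_inv_sq_mult_small. }
    assert (HC : is_lim_seq (fun M => C * / INR (S M)) 0).
    { replace (Finite 0) with (Rbar_mult C 0) by (simpl; f_equal; ring).
      apply is_lim_seq_scal_l.
      apply (is_lim_seq_incr_1 (fun M => / INR M)).
      replace (Finite 0) with (Rbar_inv p_infty) by easy.
      apply is_lim_seq_inv; [apply is_lim_seq_INR | easy]. }
    apply is_lim_seq_abs_0.
    apply (is_lim_seq_le_le (fun _ => 0) _ (fun M => C * / INR (S M))); auto.
    - intros M. split; [apply Rabs_pos | apply Hb].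
    - apply is_lim_seq_const. }
  pose proof (is_lim_seq_sum_add_eq n
    (fun i j M => sum_n (fun m => (/ half_int m ^ 2) ^ S i) M
                  * sum_n (fun l => (/ half_int l ^ 2) ^ S j) M)
    (fun i j => t_even i * t_even j)
    (fun i j => is_lim_seq_mult' _ _ _ _ (is_lim_seq_t_even i) (is_lim_seq_t_even j)))
    as H1.
  pose proof (is_lim_seq_plus' _ _ _ _ (is_lim_seq_mult' _ _ _ _
    (is_lim_seq_const (INR n + 3 / 2)) (is_lim_seq_t_even (S n))) Herr) as H2.
  apply (is_lim_seq_ext _ _ _ (square_sum n)) in H1.
  apply is_lim_seq_unique in H1. apply is_lim_seq_unique in H2.
  pose proof (eq_trans (eq_sym H1) H2) as E. injection E as E. rewrite E. ring.
Qed.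

(** * The generating function of the even values *)

Lemma t_even_ge (n : nat) : 4 ^ S n <= t_even n.
Proof.
  pose proof (sum_n_le_is_series _ _ 0 (inv_half_int_pow_nonneg _)
    (is_series_t_tilde (2 * n + 2) ltac:(lia))) as H.
  rewrite sum_O in H. eapply Rle_trans; [|exact H]. right.
  unfold half_int. simpl (INR 0). rewrite Rplus_0_l, pow_inv, Rinv_inv.
  replace 4 with (2 ^ 2) by ring. rewrite <- pow_mult. f_equal. lia.
Qed.

Lemma t_even_le (n : nat) : t_even n <= 4 ^ n * t_even 0.
Proof.
  unfold t_even.
  pose proof (is_series_t_tilde (2 * n + 2) ltac:(lia)) as Hn.
  pose proof (is_series_scal_R (4 ^ n) _ _ (is_series_t_tilde (2 * 0 + 2) ltac:(lia)))
    as H0.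
  rewrite <- (is_series_unique _ _ Hn), <- (is_series_unique _ _ H0).
  apply Series_le; [|eexists; exact H0].
  intros k. split; [apply inv_half_int_pow_nonneg|].
  rewrite !pow_add, Rinv_mult, pow_mult, <- pow_inv.
  rewrite Nat.mul_0_r, pow_O, Rmult_1_l.
  apply Rmult_le_compat_r; [apply inv_half_int_pow_nonneg|].
  apply pow_incr. split; [apply inv_half_int_pow_nonneg|].
  rewrite <- pow_inv. replace 4 with (2 ^ 2) by ring. apply pow_incr. split.
  - left. apply Rinv_0_lt_compat, half_int_pos.
  - apply inv_half_int_le.
Qed.

Lemma t_even_pos (n : nat) : 0 < t_even n.
Proof. eapply Rlt_le_trans; [|apply t_even_ge]. apply pow_lt. lra. Qed.

Lemma t_even_radius (z : R) : Rabs z < / 4 ->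
  Rbar_lt (Rabs z) (CV_radius t_even).
Proof.
  intros Hz. apply (Rbar_lt_le_trans _ (/ 4)); [exact Hz|].
  apply CV_radius_bounded. exists (t_even 0). intros n.
  rewrite Rabs_pos_eq.
  - pose proof (t_even_le n) as H. pose proof (pow_lt 4 n ltac:(lra)) as H4.
    rewrite pow_inv. apply (Rmult_le_reg_r (4 ^ n)); auto.
    rewrite Rmult_assoc, Rinv_l by lra. lra.
  - apply Rmult_le_pos; [left; apply t_even_pos | apply pow_le; lra].
Qed.

Definition t_even_fun (z : R) : R := PSeries t_even z.

Definition t_even_fun' (z : R) : R := PSeries (PS_derive t_even) z.

Lemma is_derive_t_even_fun (z : R) : Rabs z < / 4 ->
  is_derive t_even_fun z (t_even_fun' z).
Proof. intros Hz. now apply is_derive_PSeries, t_even_radius. Qed.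

(** Multiply [t_even_convolution] by [z ^ (n + 1)] and sum over [n]. *)
Lemma t_even_fun_riccati (z : R) : Rabs z < / 4 ->
  z * t_even_fun z ^ 2
  = z * t_even_fun' z + (t_even_fun z - t_even 0) / 2.
Proof.
  intros Hz. pose proof (t_even_radius z Hz) as Hr.
  pose proof (CV_radius_inside _ _ Hr) as Hex.
  unfold t_even_fun, t_even_fun'.
  assert (Hsq : PSeries t_even z ^ 2 = PSeries (PS_derive t_even) z
                  + / 2 * PSeries (PS_decr_1 t_even) z).
  { simpl. rewrite Rmult_1_r, <- PSeries_mult by auto.
    rewrite <- PSeries_scal, <- PSeries_plus.
    - apply PSeries_ext. intros n.
      change (sum_f_R0 (fun k => t_even k * t_even (n - k)%nat) n
        = INR (S n) * t_even (S n) + / 2 * t_even (S n)).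
      rewrite <- sum_n_Reals.
      change (sum_add_eq n (fun i j => t_even i * t_even j)
        = INR (S n) * t_even (S n) + / 2 * t_even (S n)).
      rewrite t_even_convolution, S_INR. field.
    - eexists. now apply is_pseries_derive.
    - apply ex_pseries_scal; [apply Rmult_comm|].
      apply CV_radius_inside. now rewrite CV_radius_decr_1. }
  rewrite Hsq. pose proof (PSeries_decr_1 _ _ Hex) as H1.
  rewrite H1. field.
Qed.

(** * The tangent and the value at 2 *)

(** The power series of [PI * tan (PI * x)]. *)
Definition tan_like (x : R) : R := 2 * x * t_even_fun (x ^ 2).

Lemma is_derive_tan_like (x : R) : Rabs x < / 2 ->
  is_derive tan_like x (tan_like x ^ 2 + 2 * t_even 0).
Proof.
  intros Hx.
  assert (Hx2 : Rabs (x ^ 2) < / 4).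
  { rewrite <- RPow_abs. pose proof (Rabs_pos x). simpl. nra. }
  pose proof (is_derive_t_even_fun _ Hx2) as Hd.
  pose proof (t_even_fun_riccati _ Hx2) as Hr.
  unfold tan_like.
  replace (_ + _) with (2 * t_even_fun (x ^ 2)
    + 2 * x * (2 * x * t_even_fun' (x ^ 2))).
  - apply (is_derive_mult (fun u => 2 * u) (fun u => t_even_fun (u ^ 2))).
    + auto_derive; auto. ring.
    + apply (is_derive_comp t_even_fun (fun u => u ^ 2)); auto.
      auto_derive; auto. ring.
    + intros; apply Rmult_comm.
  - transitivity (4 * (x ^ 2 * t_even_fun (x ^ 2) ^ 2) + 2 * t_even 0); [|ring].
    rewrite Hr. field.
Qed.

Lemma is_derive_constant (f : R -> R) (d x : R) :
  (forall u, Rabs u < d -> is_derive f u 0) -> Rabs x < d -> f x = f 0.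
Proof.
  intros Hf Hx. destruct (Rtotal_order x 0) as [H|[->|H]]; auto.
  - apply eq_is_derive; auto. intros u Hu. apply Hf.
    rewrite Rabs_left in Hx by auto. apply Rabs_def1; lra.
  - symmetry. apply eq_is_derive; auto. intros u Hu. apply Hf.
    rewrite Rabs_pos_eq in Hx by lra. apply Rabs_def1; lra.
Qed.

Lemma atan_tan_like (w x : R) : 0 < w -> w ^ 2 = 2 * t_even 0 ->
  Rabs x < / 2 -> atan (tan_like x / w) = w * x.
Proof.
  intros Hw Hw2 Hx.
  enough (atan (tan_like x / w) - w * x = atan (tan_like 0 / w) - w * 0) as H.
  { unfold tan_like in H at 2. rewrite Rmult_0_r, Rmult_0_l in H.
    unfold Rdiv in H at 2. rewrite Rmult_0_l, atan_0 in H. lra. }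
  apply (is_derive_constant (fun u => atan (tan_like u / w) - w * u) (/ 2)); auto.
  intros u Hu. pose proof (is_derive_tan_like u Hu) as Hd.
  rewrite <- Hw2 in Hd. set (g := tan_like u) in *.
  replace 0 with ((/ (1 + (g / w) ^ 2)) * ((g ^ 2 + w ^ 2) / w) - w).
  - apply (is_derive_minus (fun u => atan (tan_like u / w)) (fun u => w * u)).
    + replace (_ * _) with (scal ((g ^ 2 + w ^ 2) / w) (/ (1 + (g / w) ^ 2)))
        by (apply Rmult_comm).
      apply (is_derive_comp atan (fun u => tan_like u / w)).
      * apply is_derive_Reals. apply derivable_pt_lim_atan.
      * apply (is_derive_ext (fun u => / w * tan_like u));
          [intros; unfold Rdiv; apply Rmult_comm|].
        replace ((g ^ 2 + w ^ 2) / w) with (/ w * (g ^ 2 + w ^ 2))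
          by (unfold Rdiv; apply Rmult_comm).
        now apply is_derive_scal.
    + auto_derive; auto. ring.
  - field. split; apply Rgt_not_eq; nra.
Qed.

(** The coefficients of [t_even_fun] dominate those of [4 / (1 - 4 z)], whence
    the pole at [x = 1/2]. *)
Lemma tan_like_ge (x : R) : / 4 <= x < / 2 -> / (1 - 2 * x) <= tan_like x.
Proof.
  intros Hx.
  assert (Hx2 : Rabs (x ^ 2) < / 4).
  { rewrite Rabs_pos_eq; nra. }
  assert (Hg : is_series (fun k => 4 * (4 * x ^ 2) ^ k) (4 * / (1 - 4 * x ^ 2))).
  { apply is_series_scal_R, is_series_geom. rewrite Rabs_pos_eq; nra. }
  assert (Hs : 4 * / (1 - 4 * x ^ 2) <= t_even_fun (x ^ 2)).
  { rewrite <- (is_series_unique _ _ Hg). unfold t_even_fun, PSeries.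
    apply Series_le.
    - intros n. pose proof (t_even_ge n). split.
      + apply Rmult_le_pos; [lra|]. apply pow_le. nra.
      + rewrite Rpow_mult_distr, <- Rmult_assoc.
        apply Rmult_le_compat_r; [|exact H]. apply pow_le. nra.
    - apply ex_pseries_R. apply CV_radius_inside. now apply t_even_radius. }
  unfold tan_like.
  apply Rle_trans with (2 * x * (4 * / (1 - 4 * x ^ 2))).
  - replace (1 - 4 * x ^ 2) with ((1 - 2 * x) * (1 + 2 * x)) by ring.
    replace (2 * x * _) with (/ (1 - 2 * x) * (8 * x / (1 + 2 * x)))
      by (field; lra).
    rewrite <- (Rmult_1_r (/ (1 - 2 * x))) at 1.
    apply Rmult_le_compat_l; [left; apply Rinv_0_lt_compat; lra|].
    apply (Rmult_le_reg_r (1 + 2 * x)); [lra|].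
    unfold Rdiv. rewrite Rmult_assoc, Rinv_l by lra. lra.
  - apply Rmult_le_compat_l; lra.
Qed.

(** By [atan_tan_like], [tan_like x = w * tan (w * x)] for [0 <= x < 1/2], with
    [w ^ 2 = 2 * t_even 0]. By [tan_like_ge], the right end of this interval is
    the first pole of the tangent: [w / 2 = PI / 2]. *)
Lemma t_even_0 : t_even 0 = PI ^ 2 / 2.
Proof.
  pose proof (t_even_pos 0) as H0.
  set (w := sqrt (2 * t_even 0)).
  assert (Hw : 0 < w) by (apply sqrt_lt_R0; lra).
  assert (Hw2 : w ^ 2 = 2 * t_even 0) by (apply pow2_sqrt; lra).
  enough (w = PI) as E by (rewrite E in Hw2; lra).
  pose proof PI_RGT_0.
  apply Rle_antisym.
  - (* The arctangent stays below [PI / 2] on the whole interval. *)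
    destruct (Rle_or_lt w PI) as [|Hgt]; auto. exfalso.
    set (x := PI / 2 / w).
    assert (Hx : 0 < x < / 2).
    { unfold x. split; [apply Rdiv_lt_0_compat; lra|].
      apply (Rmult_lt_reg_r w); auto. unfold Rdiv.
      rewrite Rmult_assoc, Rinv_l by lra. lra. }
    pose proof (atan_tan_like w x Hw Hw2 ltac:(apply Rabs_def1; lra)) as E.
    pose proof (atan_bound (tan_like x / w)) as Hb. rewrite E in Hb.
    unfold x in Hb. replace (w * (PI / 2 / w)) with (PI / 2) in Hb by (field; lra).
    lra.
  - (* Otherwise [w * tan (w * x)] is bounded on it. *)
    destruct (Rle_or_lt PI w) as [|Hlt]; auto. exfalso.
    set (K := w * tan (w / 2)).
    assert (HK : 0 < K) by (apply Rmult_lt_0_compat; auto; apply tan_gt_0; lra).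
    set (x := (1 - / (K + 3)) / 2).
    assert (Hi : 0 < / (K + 3) <= / 3).
    { split; [apply Rinv_0_lt_compat; lra|]. apply Rinv_le_contravar; lra. }
    assert (Hx : / 4 <= x < / 2) by (unfold x; lra).
    pose proof (atan_tan_like w x Hw Hw2 ltac:(apply Rabs_def1; lra)) as E.
    apply (f_equal tan) in E. rewrite tan_atan in E.
    assert (Ht : tan (w * x) < tan (w / 2)).
    { apply tan_increasing; [|nra|lra].
      apply Rlt_trans with 0; [lra|]. apply Rmult_lt_0_compat; lra. }
    pose proof (tan_like_ge x Hx) as Hge.
    replace (1 - 2 * x) with (/ (K + 3)) in Hge by (unfold x; field; lra).
    rewrite Rinv_inv in Hge.
    rewrite <- E in Ht. apply (Rmult_lt_compat_l w) in Ht; auto. fold K in Ht.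
    replace (w * (tan_like x / w)) with (tan_like x) in Ht by (field; lra).
    lra.
Qed.

(** * The hyperbolic tangent and the Genocchi numbers *)

(** The power series of [tanh (t / 2)], by [tanh u = - I * tan (I * u)]. *)
Definition tanh_like (t : R) : R :=
  t / PI ^ 2 * t_even_fun (- (t / (2 * PI)) ^ 2).

Lemma tanh_like_arg (t : R) : Rabs t < PI -> Rabs (- (t / (2 * PI)) ^ 2) < / 4.
Proof.
  intros Ht. pose proof PI_RGT_0.
  assert (Hu : Rabs (t / (2 * PI)) < / 2).
  { rewrite Rabs_div, (Rabs_pos_eq (2 * PI)) by lra.
    apply (Rmult_lt_reg_r (2 * PI)); [lra|]. unfold Rdiv.
    rewrite Rmult_assoc, Rinv_l by lra. lra. }
  rewrite Rabs_Ropp, <- RPow_abs.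
  pose proof (Rabs_pos (t / (2 * PI))). simpl. nra.
Qed.

Lemma is_derive_tanh_like (t : R) : Rabs t < PI ->
  is_derive tanh_like t ((1 - tanh_like t ^ 2) / 2).
Proof.
  intros Ht. pose proof PI_RGT_0.
  pose proof (tanh_like_arg t Ht) as Hz.
  pose proof (is_derive_t_even_fun _ Hz) as Hd.
  pose proof (t_even_fun_riccati _ Hz) as Hr. rewrite t_even_0 in Hr.
  unfold tanh_like. set (z := - (t / (2 * PI)) ^ 2) in *.
  replace ((1 - (t / PI ^ 2 * t_even_fun z) ^ 2) / 2)
    with (/ PI ^ 2 * (t_even_fun z + 2 * z * t_even_fun' z)).
  - assert (Hin : is_derive (fun u => - (u / (2 * PI)) ^ 2) t
      (- (2 * t / (2 * PI) ^ 2))).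
    { auto_derive; auto. field. lra. }
    assert (Hc : is_derive (fun u => t_even_fun (- (u / (2 * PI)) ^ 2)) t
      (- (2 * t / (2 * PI) ^ 2) * t_even_fun' z)).
    { apply (is_derive_comp t_even_fun (fun u => - (u / (2 * PI)) ^ 2)); auto. }
    replace (/ PI ^ 2 * _) with (/ PI ^ 2 * t_even_fun z
      + t / PI ^ 2 * (- (2 * t / (2 * PI) ^ 2) * t_even_fun' z))
      by (unfold z; field; lra).
    apply (is_derive_mult (fun u => u / PI ^ 2)
      (fun u => t_even_fun (- (u / (2 * PI)) ^ 2))).
    + auto_derive; auto. field. lra.
    + exact Hc.
    + intros; apply Rmult_comm.
  - transitivity (/ PI ^ 2 * (2 * (z * t_even_fun z ^ 2) + PI ^ 2 / 2)).
    + rewrite Hr. field. lra.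
    + unfold z at 1. field. lra.
Qed.

Lemma tanh_like_0 : tanh_like 0 = 0.
Proof. unfold tanh_like, Rdiv. now rewrite !Rmult_0_l. Qed.

(** By the differential equation, [exp (- t) * (1 + y) / (1 - y)] is constant
    for [y = tanh_like t], as long as [y] stays below [1]. *)
Lemma tanh_like_exp : exists d : R, 0 < d /\ forall t, Rabs t < d ->
  tanh_like t = (exp t - 1) / (exp t + 1).
Proof.
  pose proof PI_RGT_0 as HPI.
  assert (Hcont : continuous tanh_like 0).
  { apply (ex_derive_continuous (V := R_NormedModule)). eexists.
    apply is_derive_tanh_like. rewrite Rabs_R0. lra. }
  destruct (Hcont (fun y => y < 1)) as [d Hd].
  { rewrite tanh_like_0. exists (mkposreal 1 Rlt_0_1). intros y Hy.
    unfold ball in Hy; simpl in Hy; unfold AbsRing_ball, abs, minus, plus, opp in Hy.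
    simpl in Hy. apply Rabs_def2 in Hy. lra. }
  exists (Rmin d PI). split; [apply Rmin_pos; [apply cond_pos | lra]|].
  intros t Ht.
  assert (Hlt : forall u, Rabs u < Rmin d PI -> tanh_like u < 1).
  { intros u Hu. apply Hd.
    unfold ball; simpl; unfold AbsRing_ball, abs, minus, plus, opp; simpl.
    rewrite Ropp_0, Rplus_0_r. eapply Rlt_le_trans; [exact Hu|]. apply Rmin_l. }
  assert (E : exp (- t) * (1 + tanh_like t) / (1 - tanh_like t) = 1).
  { transitivity (exp (- 0) * (1 + tanh_like 0) / (1 - tanh_like 0)).
    2:{ rewrite tanh_like_0, Ropp_0, exp_0. field. }
    apply (is_derive_constant (fun t =>
      exp (- t) * (1 + tanh_like t) / (1 - tanh_like t)) (Rmin d PI)); auto.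
    intros u Hu. pose proof (Hlt u Hu).
    assert (HuPI : Rabs u < PI)
      by (eapply Rlt_le_trans; [exact Hu|apply Rmin_r]).
    pose proof (is_derive_tanh_like u HuPI) as Hy.
    auto_derive.
    - repeat split; try (eexists; exact Hy). lra.
    - replace (Derive (fun x => tanh_like x) u) with ((1 - tanh_like u ^ 2) / 2)
        by (symmetry; now apply is_derive_unique).
      field. lra. }
  pose proof (Hlt t Ht). pose proof (exp_pos t).
  rewrite exp_Ropp in E.
  assert (E2 : 1 + tanh_like t = exp t * (1 - tanh_like t)).
  { transitivity (/ exp t * (1 + tanh_like t) / (1 - tanh_like t)
      * (exp t * (1 - tanh_like t))); [field; lra|]. rewrite E. ring. }
  apply (Rmult_eq_reg_r (exp t + 1)); [|lra].
  replace ((exp t - 1) / (exp t + 1) * (exp t + 1)) with (exp t - 1) by (field; lra).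
  lra.
Qed.

Lemma CV_radius_pos (a : nat -> R) (x : R) :
  0 < x -> ex_pseries a x -> Rbar_lt 0 (CV_radius a).
Proof.
  intros Hx Hex.
  destruct (Rbar_lt_le_dec (CV_radius a) (Rabs x)) as [Hlt|Hle].
  - exfalso. apply (CV_disk_outside a x Hlt).
    apply ex_series_lim_0. now apply ex_pseries_R.
  - eapply Rbar_lt_le_trans; [|exact Hle]. simpl. now apply Rabs_pos_lt, Rgt_not_eq.
Qed.

Lemma is_pseries_coef_unique (a b : nat -> R) (f : R -> R) (d : R) (n : nat) :
  0 < d ->
  (forall t, Rabs t < d -> is_pseries a t (f t)) ->
  (forall t, Rabs t < d -> is_pseries b t (f t)) ->
  a n = b n.
Proof.
  intros Hd Ha Hb.
  assert (Hd2 : Rabs (d / 2) < d) by (rewrite Rabs_pos_eq; lra).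
  apply PSeries_ext_recip.
  - apply (CV_radius_pos a (d / 2)); [lra|]. eexists; apply Ha; auto.
  - apply (CV_radius_pos b (d / 2)); [lra|]. eexists; apply Hb; auto.
  - exists (mkposreal d Hd). intros t Ht.
    unfold ball in Ht; simpl in Ht; unfold AbsRing_ball, abs, minus, plus, opp in Ht.
    simpl in Ht. rewrite Ropp_0, Rplus_0_r in Ht.
    rewrite (is_pseries_unique _ _ _ (Ha t Ht)).
    now rewrite (is_pseries_unique _ _ _ (Hb t Ht)).
Qed.

Lemma is_pseries_const (z : R) :
  is_pseries (fun n => match n with O => 1 | S _ => 0 end) z 1.
Proof.
  match goal with
  | |- is_pseries ?a ?x ?l =>
    change (is_lim_seq (sum_n (fun k => pow_n x k * a k)) l)
  end.
  apply (is_lim_seq_ext (fun _ => 1)); [|apply is_lim_seq_const].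
  intros n. induction n as [|n IH].
  - rewrite sum_O. simpl. symmetry. apply Rmult_1_r.
  - rewrite sum_n_Sr, <- IH. ring.
Qed.

(** The Taylor coefficients of [t - t * tanh (t / 2)]. *)
Definition genocchi_series_coef (n : nat) : R :=
  if Nat.odd n then match n with S O => 1 | _ => 0 end
  else PS_incr_1 (fun k => - 4 * (-1) ^ k * t_even k / (2 * PI) ^ (2 * k + 2))
         (Nat.div2 n).

Lemma is_pseries_genocchi_series_coef (t : R) : Rabs t < PI ->
  is_pseries genocchi_series_coef t (t - t * tanh_like t).
Proof.
  intros Ht. pose proof PI_RGT_0 as HPI.
  set (z := - (t / (2 * PI)) ^ 2).
  replace (t - t * tanh_like t)
    with (t ^ 2 * (- / PI ^ 2 * t_even_fun z) + t * 1)
    by (unfold tanh_like; fold z; field; lra).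
  apply is_pseries_odd_even.
  - apply (is_pseries_ext (PS_incr_1
      (fun k => - 4 * (-1) ^ k * t_even k / (2 * PI) ^ (2 * k + 2)))).
    { intros n. unfold genocchi_series_coef.
      rewrite Nat.odd_mul, Nat.div2_double. reflexivity. }
    apply (is_pseries_incr_1 (V := R_NormedModule) _ (t ^ 2)).
    apply is_pseries_R.
    apply (is_series_eq (fun k => - / PI ^ 2 * (t_even k * z ^ k)) _
      (- / PI ^ 2 * t_even_fun z)); auto.
    + intros k. unfold z. rewrite pow_add, (pow_mult (2 * PI)).
      replace (- (t / (2 * PI)) ^ 2) with ((-1) * (t ^ 2 * / (2 * PI) ^ 2))
        by (field; lra).
      replace (/ PI ^ 2) with (4 * / (2 * PI) ^ 2) by (field; lra).
      assert (HP : (2 * PI) ^ 2 <> 0) by (apply pow_nonzero; lra).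
      set (P := (2 * PI) ^ 2) in *.
      rewrite !Rpow_mult_distr, (pow_inv P).
      field. split; auto. now apply pow_nonzero.
    + apply is_series_scal_R. apply is_pseries_R.
      apply PSeries_correct, CV_radius_inside, t_even_radius.
      now apply tanh_like_arg.
  - apply (is_pseries_ext (fun n => match n with O => 1 | S _ => 0 end));
      [|apply is_pseries_const].
    intros n. unfold genocchi_series_coef.
    rewrite Nat.odd_add, Nat.odd_mul. simpl.
    destruct n as [|n]; [easy|].
    replace (S n + (S n + 0) + 1)%nat with (S (S (S (n + n)))) by lia. easy.
Qed.

(** Compare the coefficients of two power series for [2 * t / (exp t + 1)]. *)
Lemma genocchi_t_even (G : nat -> R) (k : nat) : is_genocchi G ->
  G (2 * k + 2)%nat / INR (fact (2 * k + 2)) * (2 * PI) ^ (2 * k + 2)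
  = - 4 * (-1) ^ k * t_even k.
Proof.
  intros (rho & Hrho & HG). pose proof PI_RGT_0 as HPI.
  destruct tanh_like_exp as (d & Hd & Htanh).
  set (e := fun n => match n with O => 0 | S _ => G n / INR (fact n) end).
  set (r := Rmin rho (Rmin d PI)).
  assert (Hr : 0 < r) by (repeat apply Rmin_pos; lra).
  assert (He : forall t, Rabs t < r ->
    is_pseries e t (2 * t / (exp t + 1))).
  { intros t Ht.
    assert (Ht1 : Rabs t < rho)
      by (eapply Rlt_le_trans; [exact Ht | apply Rmin_l]).
    apply is_pseries_R. apply (is_series_decr_1 (V := R_NormedModule)).
    refine (is_series_eq _ _ _ _ _ _ (HG t Ht1)).
    - intros n. unfold e. unfold Rdiv. ring.
    - unfold e, plus, opp; simpl. ring. }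
  assert (Hc : forall t, Rabs t < r ->
    is_pseries genocchi_series_coef t (2 * t / (exp t + 1))).
  { intros t Ht.
    assert (Ht2 : Rabs t < Rmin d PI)
      by (eapply Rlt_le_trans; [exact Ht | apply Rmin_r]).
    replace (2 * t / (exp t + 1)) with (t - t * tanh_like t).
    - apply is_pseries_genocchi_series_coef.
      eapply Rlt_le_trans; [exact Ht2 | apply Rmin_r].
    - rewrite Htanh by (eapply Rlt_le_trans; [exact Ht2 | apply Rmin_l]).
      pose proof (exp_pos t). field. lra. }
  pose proof (is_pseries_coef_unique e _ _ r (2 * S k) Hr He Hc) as E.
  change (e (2 * S k)%nat) with (G (2 * S k)%nat / INR (fact (2 * S k))) in E.
  replace (2 * k + 2)%nat with (2 * S k)%nat by lia.
  rewrite E. unfold genocchi_series_coef.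
  rewrite Nat.odd_mul, Nat.div2_double. cbn [Nat.odd Nat.even negb andb PS_incr_1].
  replace (2 * k + 2)%nat with (2 * S k)%nat by lia.
  assert ((2 * PI) ^ (2 * S k) <> 0) by (apply pow_nonzero; lra).
  field. auto.
Qed.

(** * Signs and parities *)

Lemma odd_indicator (n : nat) (x : R) :
  (if Nat.odd n then x else 0) = (1 - (-1) ^ n) / 2 * x.
Proof.
  destruct (Nat.odd n) eqn:E.
  - apply Nat.odd_spec in E as [k ->].
    rewrite Nat.add_1_r, pow_1_odd. field.
  - assert (He : Nat.even n = true) by now rewrite <- Nat.negb_odd, E.
    apply Nat.even_spec in He as [k ->]. rewrite pow_1_even. field.
Qed.

Lemma pow_opp1_sq (n : nat) : (-1) ^ n * (-1) ^ n = 1.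
Proof.
  rewrite <- pow_add. replace (n + n)%nat with (2 * n)%nat by lia.
  apply pow_1_even.
Qed.

Theorem theorem3p6 (G : nat -> R) (hG : is_genocchi G)
    (q p : nat) (hq : (2 <= q)%nat) (hp : (1 <= p)%nat) (hodd : Nat.Odd p) :
  (-1) ^ (q - 1) *
    sum_add_eq (p - 1) (fun i j =>
      Binomial.C (q + i - 1) i * Binomial.C (q + j - 1) j * T (q + i) (q + j))
  + sum_add_eq (q - 1) (fun i j =>
      Binomial.C (p + i - 1) i * Binomial.C (q + j - 1) j * S_tilde (p + i) (q + j))
  = (-1) ^ (q - 1) *
      sum_n (fun i =>
        if Nat.odd (q + i) then
          Binomial.C (q + i - 1) i * Binomial.C (p + q - 2 - i) (p - 1 - i)
          * t_tilde (q + i) * t_tilde (p + q - 1 - i)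
        else 0) (p - 1)
    + (-1) ^ ((p - 1) / 2) / 8
      * Binomial.C (p + 2 * q - 2) (p - 1)
      * (G (p - 1 + 2 * q)%nat / INR (fact (p - 1 + 2 * q)))
      * (2 * PI) ^ (p - 1 + 2 * q).
Proof.
  destruct hodd as [m ->]. destruct q as [|q]; [lia|].
  replace (2 * m + 1 - 1)%nat with (2 * m)%nat by lia.
  replace (S q - 1)%nat with q by lia.
  replace (2 * m / 2)%nat with m by (rewrite Nat.mul_comm, Nat.div_mul; lia).
  replace (2 * m + 2 * S q)%nat with (2 * (m + q) + 2)%nat by lia.
  replace (2 * m + 1 + 2 * S q - 2)%nat with (2 * S q + 2 * m - 1)%nat by lia.
  rewrite (C_multichoose (2 * S q)) by lia.
  pose proof (T_sum (S q) (2 * m) hq) as HT.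
  pose proof (S_tilde_sum q (2 * m) ltac:(lia) ltac:(now exists m)) as HS.
  pose proof (genocchi_t_even G (m + q) hG) as HG.
  unfold t_even in HG.
  set (r := (2 * m)%nat) in *.
  set (ST := sum_add_eq r _) in HT.
  set (SS := sum_add_eq q _) in HS.
  (* Summed as it stands, [P] comes from the [T]; summed with the signs
     [(-1) ^ i], it comes from the [S_tilde]. *)
  set (P := fun i j => multichoose (S q) i * multichoose (S q) j
    * (t_tilde (S q + i) * t_tilde (S q + j))).
  change (2 * ST = sum_add_eq r P - multichoose (2 * S q) r * t_tilde (2 * S q + r))
    in HT.
  rewrite (sum_add_eq_ext r _ (fun i j => (-1) ^ i * P i j)) in HS
    by (intros; unfold P; ring).
  rewrite (sum_add_eq_ext r (fun i j => Binomial.C _ _ * _ * _)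
    (fun i j => multichoose (S q) i * multichoose (S q) j * T (S q + i) (S q + j)))
    by (intros; rewrite !C_multichoose by lia; reflexivity).
  fold ST.
  rewrite (sum_add_eq_ext q _ (fun i j => multichoose (S r) i
    * multichoose (S q) j * S_tilde (S r + i) (S q + j))).
  2:{ intros i j _. rewrite !C_multichoose by lia.
      now replace (r + 1)%nat with (S r) by lia. }
  fold SS.
  match goal with |- context [sum_n ?f r] => set (odd_terms := f) end.
  assert (Hodd : sum_n odd_terms r
    = / 2 * (sum_add_eq r P + (-1) ^ q * sum_add_eq r (fun i j => (-1) ^ i * P i j))).
  { rewrite <- !sum_add_eq_scal, <- sum_add_eq_plus, <- sum_add_eq_scal.
    apply sum_n_eq. intros i Hi. unfold odd_terms.
    rewrite odd_indicator, C_multichoose by lia.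
    replace (r + 1 + S q - 2 - i)%nat with (S q + (r - i) - 1)%nat by lia.
    replace (r + 1 - 1 - i)%nat with (r - i)%nat by lia.
    rewrite C_multichoose by lia.
    replace (r + 1 + S q - 1 - i)%nat with (S q + (r - i))%nat by lia.
    unfold P. rewrite pow_add. simpl pow. field. }
  rewrite Hodd.
  rewrite (Rmult_assoc _ (G _ / _)), HG.
  replace (2 * (m + q) + 2)%nat with (2 * S q + r)%nat by (unfold r; lia).
  rewrite (pow_add (-1) m q).
  pose proof (pow_opp1_sq m) as Em. pose proof (pow_opp1_sq q) as Eq.
  replace ST with ((2 * ST) / 2) by field. rewrite HT.
  replace SS with ((2 * SS) / 2) by field. rewrite HS.
  set (X := sum_add_eq r P). set (Y := sum_add_eq r _).
  transitivity ((-1) ^ q * (/ 2 * X) + ((-1) ^ q * (-1) ^ q) * / 2 * Y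
    - ((-1) ^ m * (-1) ^ m) * / 2 * (-1) ^ q
      * (multichoose (2 * S q) r * t_tilde (2 * S q + r))); [|field].
  rewrite Em, Eq. field.
Qed.
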